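(* Let $a\ge 1$ be an integer. For time $t\in\mathbb{R}^{+}$, let $W(t)$ and $B(t)$ be respectively the number of white and blue balls in a (tenable) constant-differentials Pólya process with the replacement matrix $\begin{pmatrix} -a & -a\\ a & a\end{pmatrix}$ and of differential index $\Delta = B(0)-W(0)\ge 1$, and let $\tau(t)=W(t)+B(t)$ be the total number of balls. Then, as $t\to\infty$, $$\frac{B(t)}{t}\ \overset{D}{\longrightarrow}\ \mathrm{Gamma}\Bigl(\frac{\Delta}{a},\,a^2\Bigr),\qquad \frac{\tau(t)}{t}\ \overset{D}{\longrightarrow}\ 2\,\mathrm{Gamma}\Bigl(\frac{\Delta}{a},\,a^2\Bigr).$$
   Context: Constant-differentials Pólya process: an urn starts with fixed (deterministic) numbers $W(0)\ge 0$ of white and $B(0)\ge 0$ of blue balls. Each ball in the urn carries a clock that rings after an exponential time with mean $1$, all clocks being independent of each other and of the past; newly added balls get their own independent clocks. When the clock of a ball rings (an epoch), that ball is drawn, put back, and the replacement rule is executed instantaneously. Rows of the replacement matrix are indexed by the colour of the drawn ball (white, then blue) and columns by the colour added (white, then blue), a negative entry meaning removal. With the matrix $\begin{pmatrix} -a & -a\\ a & a\end{pmatrix}$: if a white ball is drawn, $a$ white and $a$ blue balls are removed; if a blue ball is drawn, $a$ white and $a$ blue balls are added. Thus $B(t)-W(t)=\Delta$ for all $t$; the constant $\Delta$ is called the differential index. The process is assumed tenable: on every possible stochastic path the rule can be executed forever, i.e. the urn is never empty when a draw is needed, and there are always enough balls of each colour to carry out the required removals. $\mathrm{Gamma}(\alpha,\beta)$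 denotes the gamma distribution with shape parameter $\alpha$ and scale parameter $\beta$ (moment generating function $(1-\beta x)^{-\alpha}$ for $x<1/\beta$), and $2\,\mathrm{Gamma}(\alpha,\beta)$ denotes the distribution of $2G$ where $G$ has the $\mathrm{Gamma}(\alpha,\beta)$ distribution. $\overset{D}{\longrightarrow}$ denotes convergence in distribution. *)

(* Defs.v *)
(* MathComp / MathComp-Analysis *)
From HB Require Import structures.
From mathcomp Require Import all_boot all_order all_algebra.
From mathcomp Require Import all_classical all_reals all_analysis.
Set Implicit Arguments.
Unset Strict Implicit.
Unset Printing Implicit Defensive.
Import Order.TTheory GRing.Theory Num.Theory.
Import numFieldNormedType.Exports.

Local Open Scope classical_set_scope.
Local Open Scope ring_scope.

Definition white : 'I_2 := ord0.
Definition blue : 'I_2 := ord_max.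

Definition by_colour (A : Type) (x y : A) (c : 'I_2) : A :=
  if c == white then x else y.

(* Replacement matrices are indexed by the colour drawn (row) and the colour
   added (column); a negative entry means removal. *)
Definition constant_differentials (a : nat) : 'M[int]_2 :=
  \matrix_(c < 2, e < 2) by_colour (- a%:Z) a%:Z c.

Section Tenability.
Variables (A : 'M[int]_2) (x0 : 'I_2 -> nat).

Inductive reachable : ('I_2 -> nat) -> Prop :=
| reachable_init : reachable x0
| reachable_draw x c y : reachable x -> (0 < x c)%N ->
    (forall e, (y e)%:Z = (x e)%:Z + A c e) -> reachable y.

Definition tenable : Prop := forall x, reachable x ->
  (exists c, (0 < x c)%N) /\
  (forall c, (0 < x c)%N -> forall e, 0 <= (x e)%:Z + A c e).

End Tenability.

Section UrnPath.
Variable R : realType.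

(* The urn just after an epoch: the time of that epoch (0 at the start), for
   each colour the absolute times at which the clocks of the balls of that
   colour will ring, and the balls drawn so far (most recent first), each
   given by its colour and its position in the list of its colour. *)
Record urn := Urn {
  epoch : R;
  rings : 'I_2 -> seq R;
  draws : seq ('I_2 * nat) }.

(* [keep h e n k] is the mask of the balls that stay when k of the n balls of
   colour e are removed, h being the list of draws up to and including the
   current one.  Which balls of a colour are removed is left unspecified,
   except that the choice cannot look at the pending clocks. *)
Definition removal_rule (keep : seq ('I_2 * nat) -> 'I_2 -> nat -> nat -> bitseq)
  : Prop :=
  forall h e n k, (k <= n)%N ->
    size (keep h e n k) = n /\ count_mem false (keep h e n k) = k.

Variables (A : 'M[int]_2) (x0 : 'I_2 -> nat).
Variable keep : seq ('I_2 * nat) -> 'I_2 -> nat -> nat -> bitseq.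
(* [E (n, e, k)] are the durations of the clocks: for n = 0 those of the
   initial balls; for n > 0 those started at the n-th epoch, where k = 0 is
   the new clock of the ball drawn and put back, and k.+1 that of the k-th
   added ball of colour e. *)
Variable E : nat * 'I_2 * nat -> R.

Definition init_urn : urn :=
  Urn 0 (fun e => mkseq (fun k => E (0%N, e, k)) (x0 e)) [::].

Definition earliest (l : seq R) : R := \big[Num.min/head 0 l]_(r <- l) r.

Definition draw (u : urn) : urn :=
  let s := earliest (rings u white ++ rings u blue) in
  let c := if s \in rings u white then white else blue in
  let i := index s (rings u c) in
  let n := (size (draws u)).+1 in
  let h := (c, i) :: draws u in
  let back e := if e == c then set_nth 0 (rings u c) i (s + E (n, c, 0%N))
                else rings u e in
  let replace e := match A c e with
    | Posz k => back e ++ mkseq (fun j => s + E (n, e, j.+1)) k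
    | Negz k => mask (keep h e (size (back e)) k.+1) (back e)
    end in
  Urn s replace h.

Definition urn_after (n : nat) : urn := iter n draw init_urn.

End UrnPath.

Definition mutually_independent d (T : measurableType d) (R : realType)
    (P : probability T R) (I : eqType) (X : I -> {RV P >-> R}) : Prop :=
  forall (s : seq I) (V : I -> set R), uniq s -> (forall i, measurable (V i)) ->
    P (\bigcap_(i in [set` s]) (X i @^-1` V i)) =
    (\prod_(i <- s) P (X i @^-1` V i))%E.

(* [X e t] is the number of balls of colour e at time t.  It is prescribed
   almost surely, by the number of balls after the last epoch up to t. *)
Definition polya_process d (T : measurableType d) (R : realType)
    (P : probability T R) (A : 'M[int]_2) (x0 : 'I_2 -> nat)
    (X : 'I_2 -> R -> {RV P >-> nat}) : Prop :=
  exists (keep : seq ('I_2 * nat) -> 'I_2 -> nat -> nat -> bitseq)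
         (clock : nat * 'I_2 * nat -> {RV P >-> R}),
  [/\ removal_rule keep,
      mutually_independent clock,
      (forall i V, measurable V -> distribution P (clock i) V = exponential_prob 1 V)
    & {ae P, forall w : T,
        let urn_at := urn_after A x0 keep (fun i => clock i w) in
        forall (n : nat) (t : R),
          epoch (urn_at n) <= t < epoch (urn_at n.+1) ->
          forall e, X e t w = size (rings (urn_at n) e)}].

Section GammaDistribution.
Variable R : realType.

Definition gamma_fun (alpha : R) : R :=
  \int[lebesgue_measure]_(x in `]0, +oo[) (x `^ (alpha - 1) * expR (- x)).

Definition gamma_pdf (alpha beta x : R) : R :=
  if 0 < x then
    x `^ (alpha - 1) * expR (- (x / beta)) / (gamma_fun alpha * beta `^ alpha)
  else 0.

Definition gamma_prob (alpha beta : R) (V : set R) : \bar R :=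
  (\int[lebesgue_measure]_(x in V) (gamma_pdf alpha beta x)%:E)%E.

End GammaDistribution.

(* Convergence of the distribution functions at the continuity points of the
   distribution function of the limit law mu. *)
Definition cvg_in_distribution d (T : measurableType d) (R : realType)
    (P : probability T R) (X : R -> T -> R) (mu : set R -> \bar R) : Prop :=
  forall x : R, {for x, continuous (fun y : R => mu `]-oo, y]%classic)} ->
    P [set w | X t w <= x] @[t --> +oo] --> mu `]-oo, x]%classic.

(* Main.v *)
Require Import Defs.
From HB Require Import structures.
From mathcomp Require Import all_boot all_order all_algebra.
From mathcomp Require Import all_classical all_reals all_analysis.
From mathcomp Require Import measurable_realfun ring lra.

(** Write D for the differential index.  Tenability forces a to divide W(0)
    (lemma [tenable_dvd]): otherwise drawing white balls repeatedly leads to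
    between 1 and a - 1 of them, a state in which the removal is impossible.
    Hence W = a k and B = a k + D at all times, where k goes up at rate
    a k + D, the number of blue balls, and down at rate a k.  So k is a linear
    birth and death chain with equal birth and death rates per unit and with
    immigration at rate D, and its generating function is explicit: for
    sigma = 1 - z,

      E z^k(t) = (1 + a sigma t)^(- D / a)
                 (1 - sigma / (1 + a sigma t))^k(0).

    With z = exp (- theta a / t), that is sigma ~ a theta / t, the right side
    tends to (1 + a^2 theta)^(- D / a), the Laplace transform of
    Gamma(D / a, a^2), while a k / t and B / t differ by D / t only.  The
    total is 2 a k + D, so half of it is treated in the same way with D / 2 in
    place of D as the additive constant.

    The work lies in reaching the formula from the description of the urn by
    individual clocks.

    - Markov property.  The durations of all clocks form a random point of a
      product space, of which only the law matters.  Lemma [first_clock] treats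
      the event that a given clock rings first: the ringing time s has density
      exp (- N s), N being the number of running clocks, and at time s the
      residual durations of the others are again independent exponentials,
      independent of s.  Balls carry the index of their clock as a label, new
      balls get labels never used before, and so the urn after the first draw
      is an urn of the same kind.  This gives the first-step recursion
      [mean_afterS] for the mean of any functional of the urn after n draws.
      Such a functional is measurable because the urn can be run symbolically,
      on random variables in place of numbers, the draws being a countable case
      distinction ([measurable_iter_draw]).

    - Absence of explosion.  The number of balls grows by at most 2 a per draw,
      so E exp (- 2 a T_n), with T_n the n-th epoch, is at most a product
      that telescopes to N / (N + 2 a n) ([mean_discount_le]).

    - Generating function.  If g is a nonnegative solution of the backward
      equation with initial value phi, then g(t - T_n, k_n), cut off at t, loses
      at each draw in mean exactly the mean of phi(k_n) on the event that t falls
      between T_n and T_(n+1) ([mean_telescope]).  Summing over n yields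
      E phi(k(t)) <= g(t, k(0)) ([expectation_le_backward]).  Both z^k and
      1 - z^k have explicit nonnegative solutions, which add up to 1, and so
      equality holds ([expectation_pgf]).

    - Convergence.  For large theta and N close to exp (theta y) the function
      (1 - exp (- theta v))^N is close to the indicator of v > y.  It is a
      polynomial in exp (- theta v), so its mean is controlled by Laplace
      transforms ([laplace_cvg_cdf]). *)

Set Implicit Arguments.
Unset Strict Implicit.
Unset Printing Implicit Defensive.
Import Order.TTheory GRing.Theory Num.Theory.
Import numFieldNormedType.Exports.

Local Open Scope classical_set_scope.
Local Open Scope ring_scope.

(** * Integration against a density and affine substitution *)

Section density.
Local Open Scope ereal_scope.
Context d (T : measurableType d) (R : realType).
Variables (mu nu : {measure set T -> \bar R}) (w : T -> R).
Hypothesis mw : measurable_fun [set: T] w.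
Hypothesis w0 : forall x, (0 <= w x)%R.
Hypothesis nuE : forall A, measurable A -> nu A = \int[mu]_(x in A) (w x)%:E.

Import HBNNSimple.

(** The densities below are given by their integrals over measurable sets, so
    the identity holds for indicators; simple functions and monotone limits
    follow. *)
Lemma ge0_integral_density (f : T -> \bar R) :
  measurable_fun [set: T] f -> (forall x, 0 <= f x) ->
  \int[nu]_x f x = \int[mu]_x (f x * (w x)%:E).
Proof.
move=> mf f0.
pose f_ := nnsfun_approx measurableT mf.
transitivity (lim (\int[nu]_x (f_ n x)%:E @[n --> \oo])).
  rewrite -monotone_convergence//=.
  - apply: eq_integral => x _; apply/esym/cvg_lim => //=.
    exact: cvg_nnsfun_approx.
  - by move=> n; exact/measurable_EFinP/measurable_funTS.
  - by move=> n x _; rewrite lee_fin.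
  - by move=> x _ a b ab; rewrite lee_fin; exact/lefP/nd_nnsfun_approx.
transitivity (lim (\int[mu]_x ((f_ n x)%:E * (w x)%:E) @[n --> \oo])); last first.
  rewrite -monotone_convergence//=.
  - apply: eq_integral => x _; apply/cvg_lim => //=.
    by apply: cvgeZr => //; exact: cvg_nnsfun_approx.
  - by move=> n; apply: emeasurable_funM; exact/measurable_EFinP.
  - by move=> n x _; rewrite mule_ge0// lee_fin.
  - move=> x _ a b ab; rewrite lee_wpmul2r ?lee_fin//.
    exact/lefP/nd_nnsfun_approx.
apply: (congr1 (fun g : (\bar R)^nat => lim (g @ \oo))); apply/funext => n.
rewrite (eq_integral (fun x => \sum_(k \in range (f_ n))
    (k%:E * (\1_(f_ n @^-1` [set k]) x)%:E))); last first.
  by move=> x _; rewrite fimfunE -fsumEFin//.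
rewrite ge0_integral_fsum//; last 2 first.
  - by move=> r; exact/measurable_EFinP/measurable_funM.
  - by move=> r x _; rewrite nnfun_muleindic_ge0.
rewrite [RHS](eq_integral (fun x => \sum_(k \in range (f_ n))
    (k%:E * (\1_(f_ n @^-1` [set k]) x)%:E * (w x)%:E))); last first.
  move=> x _; rewrite fimfunE -fsumEFin// ge0_mule_fsuml//.
  by move=> r; rewrite nnfun_muleindic_ge0.
rewrite ge0_integral_fsum//; last 2 first.
  - move=> r; apply: emeasurable_funM; last exact/measurable_EFinP.
    exact/measurable_EFinP/measurable_funM.
  - move=> r x _; apply: mule_ge0; last by rewrite lee_fin.
    by rewrite nnfun_muleindic_ge0.
apply: eq_fsbigr => r _.
have [r0|r0] := leP 0%R r; last first.
  rewrite preimage_nnfun0// !indic0 !integral0_eq//.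
  - by move=> x _; rewrite mule0 mul0e.
  - by move=> x _; rewrite mule0.
rewrite ge0_integralZl//; last exact/measurable_EFinP.
rewrite integral_indic// setIT nuE//.
transitivity (r%:E * \int[mu]_x ((w x)%:E * (\1_(f_ n @^-1` [set r]) x)%:E)).
  rewrite [in LHS]integral_mkcond; congr (_ * _); apply: eq_integral => x _.
  by rewrite epatch_indic.
rewrite -ge0_integralZl//.
- by apply: eq_integral => x _; rewrite -muleA; congr (_ * _); rewrite muleC.
- by apply: emeasurable_funM; exact/measurable_EFinP.
- by move=> x _; rewrite mule_ge0 ?lee_fin.
Qed.

End density.

Section affine.
Local Open Scope ereal_scope.
Context {R : realType}.
Local Notation mu := (@lebesgue_measure R).

(** Lebesgue measure is characterized by the lengths of intervals, and the
    image of c times Lebesgue measure under x |-> c x + b has the same lengths. *)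
Lemma ge0_integral_affine (c b : R) (f : R -> \bar R) : (0 < c)%R ->
  measurable_fun [set: R] f -> (forall x, 0 <= f x) ->
  \int[mu]_x f x = c%:E * \int[mu]_x f (c * x + b)%R.
Proof.
move=> c0 mf f0.
have mphi : @measurable_fun _ _ (measurableTypeR R) (measurableTypeR R) setT
    (fun x : R => c * x + b)%R.
  by apply: measurable_funD => //; exact: measurable_funM.
set phi := (fun x : R => c * x + b)%R in mphi.
have mE A : measurable A ->
    mu A = mscale (NngNum (ltW c0)) (pushforward mu (phi : _ -> measurableTypeR R)) A.
  apply: lebesgue_measure_unique => _ [[x y] _ <-] /=.
  transitivity (c%:E * mu `](x - b) / c, (y - b) / c]%classic%R).
    rewrite !lebesgue_measure_itv/= !lte_fin ltr_pM2r ?invr_gt0// ltrD2r.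
    case: ifPn => xy; last by rewrite mule0.
    rewrite -!EFinB -EFinM -mulrBl mulrCA mulfV ?gt_eqF// mulr1.
    by rewrite opprB addrA subrK.
  congr (_ * mu _).
  apply/seteqP; split => z /=; rewrite /phi !in_itv/= ltr_pdivrMr// ler_pdivlMr//;
  by rewrite ltrBlDr lerBrDr ![(z * c)%R]mulrC.
rewrite (eq_measure_integral _ (fun A mA _ => mE mphi A mA)).
rewrite ge0_integral_mscale//=; congr (_ * _).
by rewrite ge0_integral_pushforward.
Qed.

End affine.

Lemma measurable_bool_indic d (T : measurableType d) (R : realType) (b : T -> bool) :
  measurable_fun [set: T] b -> measurable_fun [set: T] (fun x => (b x)%:R%:E : \bar R).
Proof.
move=> mb; apply/measurable_EFinP.
rewrite (_ : (fun _ => _) = \1_(b @^-1` [set true])).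
  by apply: measurable_indic; rewrite -[X in measurable X]setTI; exact: mb.
apply/funext => x; rewrite indicE; congr (nat_of_bool _)%:R.
by apply/idP/idP => [bx|/set_mem//]; exact/mem_set.
Qed.

Lemma integral_probability_cst d (T : measurableType d) (R : realType)
  (P : probability T R) (r : \bar R) : (\int[P]_x r = r)%E.
Proof. by rewrite integral_cst// [X in (_ * X)%E]probability_setT mule1. Qed.

Lemma measurable_expR_scale (R : realType) (c : R) (B : set R) :
  measurable_fun B (fun s => (expR (- (c * s)))%:E).
Proof.
apply: measurable_funTS; apply/measurable_EFinP; apply: measurableT_comp => //.
by apply: measurableT_comp => //; exact: measurable_funM.
Qed.

(** * Exponential clocks and the space of all clocks *)

Definition expo1 (R : realType) : probability (measurableTypeR R) R.
Proof. refine (exponential_prob 1 : probability _ R); exact: ltr01. Defined.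

Section expo1.
Local Open Scope ereal_scope.
Variable R : realType.
Local Notation mu := (@lebesgue_measure R).

Lemma integral_expo1 (F : R -> \bar R) :
  measurable_fun [set: R] F -> (forall x, 0 <= F x) ->
  \int[expo1 R]_x F x = \int[mu]_(x in `]0%R, +oo[) (F x * (expR (- x))%:E).
Proof.
move=> mF F0.
rewrite (@ge0_integral_density _ _ _ mu (expo1 R) (exponential_pdf 1))//; last 2 first.
- exact: measurable_exponential_pdf.
- by move=> x; exact: exponential_pdf_ge0.
have me : measurable_fun [set: R] (fun x => (expR (- x))%:E).
  by apply/measurable_EFinP; apply: measurableT_comp.
rewrite integral_itv_obnd_cbnd; last first.
  by apply: measurable_funTS; exact: emeasurable_funM.
rewrite [RHS]integral_mkcond; apply: eq_integral => x _.
rewrite patchE /exponential_pdf patchE; case: ifPn => _; last by rewrite mule0.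
by rewrite mul1r mulN1r.
Qed.

Lemma expo1_memoryless (s : R) (F : R -> \bar R) : (0 <= s)%R ->
  measurable_fun [set: R] F -> (forall x, 0 <= F x) ->
  \int[expo1 R]_x ((s < x)%R%:R%:E * F x) =
  (expR (- s))%:E * \int[expo1 R]_x F (x + s)%R.
Proof.
move=> s0 mF F0.
have mi : measurable_fun [set: R] (fun x => (s < x)%R%:R%:E : \bar R).
  by apply: measurable_bool_indic; exact: measurable_fun_ltr.
have mFs : measurable_fun [set: R] (fun x => F (x + s)%R).
  by apply: measurableT_comp => //; exact: measurable_funD.
rewrite !integral_expo1//; last 2 first.
- exact: emeasurable_funM.
- by move=> x; rewrite mule_ge0// lee_fin.
have me : measurable_fun [set: R] (fun x => (expR (- x))%:E).
  by apply/measurable_EFinP; apply: measurableT_comp => //.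
rewrite integral_mkcond (@ge0_integral_affine _ 1 s)//; last 2 first.
- apply/(measurable_restrictT _ _).1 => //.
  by apply: measurable_funTS; do 2 apply: emeasurable_funM => //.
- by move=> x; rewrite patchE; case: ifPn => // _; rewrite !mule_ge0// lee_fin// expR_ge0.
rewrite mul1e -ge0_integralZl//; last 2 first.
- by apply: measurable_funTS; apply: emeasurable_funM.
- by move=> x _; rewrite mule_ge0// lee_fin expR_ge0.
rewrite [RHS]integral_mkcond; apply: eq_integral => x _.
rewrite !patchE !mem_setE !in_itv/= !andbT mul1r ltrDr.
have [x0|x0] := ltP 0%R x.
  by rewrite ltr_wpDr// mul1e opprD expRD mulrC EFinM muleCA.
by case: ifP => //; rewrite !mul0e.
Qed.

End expo1.

(** Functions on the set of labels with the sigma-algebra generated by the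
    conditions on finitely many coordinates.  The durations of the clocks of an
    urn are a random point of this space, and independent durations determine
    its law. *)
Section clock_space.
Variables (R : realType) (I : eqType).

Definition cylinder (s : seq I) (V : I -> set R) : set (I -> R) :=
  [set w | forall i, i \in s -> V i (w i)].

Definition cylinders : set (set (I -> R)) :=
  [set A | exists s V, (forall i, measurable (V i)) /\ A = cylinder s V].

Definition clock_space := g_sigma_algebraType cylinders.

Lemma measurable_cylinder (s : seq I) V : (forall i, measurable (V i)) ->
  measurable (cylinder s V : set clock_space).
Proof. by move=> mV; apply: sub_sigma_algebra; exists s, V. Qed.

Lemma measurable_coord (i : I) :
  measurable_fun [set: clock_space] (fun w : clock_space => w i : R).
Proof.
move=> _ V mV; rewrite setTI.
rewrite (_ : _ @^-1` _ = cylinder [:: i] (fun=> V)); first exact: measurable_cylinder.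
by apply/seteqP; split => w /= h; [move=> j /[!inE]/eqP->|apply: h; rewrite inE].
Qed.

Lemma cylinder_nil V : cylinder [::] V = setT.
Proof. by apply/seteqP; split => w. Qed.

Lemma cylinder_cons i s V :
  cylinder (i :: s) V = [set w | V i (w i)] `&` cylinder s V.
Proof.
apply/seteqP; split => w /= h.
  by split => [|j js]; apply: h; rewrite inE ?eqxx// js orbT.
by move=> j; rewrite inE => /predU1P[->|]; [exact: h.1|exact: h.2].
Qed.

Lemma measurable_fun_coord d (T : measurableType d) (f : T -> clock_space) :
  (forall i, measurable_fun [set: T] (fun x => f x i : R)) ->
  measurable_fun [set: T] f.
Proof.
move=> mf; apply: (@measurability _ _ _ clock_space _ _ (cylinders : set (set clock_space))) => //.
move=> _ [_ [s [V [mV ->]]] <-]; rewrite setTI.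
elim: s => [|i s IHs]; first by rewrite cylinder_nil preimage_setT.
rewrite cylinder_cons preimage_setI; apply: measurableI => //.
by rewrite -[X in measurable X]setTI; exact: (mf i _ (V i)).
Qed.

Lemma cylinder_undup (s : seq I) V : cylinder (undup s) V = cylinder s V.
Proof. by apply/seteqP; split => w /= h i; have := h i; rewrite mem_undup. Qed.

Lemma setI_closed_cylinders : setI_closed cylinders.
Proof.
move=> _ _ [s [V [mV ->]]] [s' [V' [mV' ->]]].
exists (s ++ s'), (fun i => (if i \in s then V i else setT) `&`
                            (if i \in s' then V' i else setT)); split.
  by move=> i; apply: measurableI; case: ifP.
apply/seteqP; split => w /=.
  move=> [h h'] i; rewrite mem_cat => _; split; case: ifPn => // si.
    exact: h.
  exact: h'.
move=> h; split => i si; have := h i; rewrite mem_cat si ?orbT => /(_ isT)[//].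
Qed.

Lemma clock_space_unique (m1 m2 : probability clock_space R) :
  (forall s V, uniq s -> (forall i, measurable (V i)) ->
    m1 (cylinder s V) = m2 (cylinder s V)) ->
  forall A, measurable A -> m1 A = m2 A.
Proof.
move=> h; apply: (@measure_unique _ _ clock_space
  (cylinders : set (set clock_space)) (fun=> setT)) => //.
- exact: setI_closed_cylinders.
- by move=> i; exists [::], (fun=> setT); rewrite cylinder_nil.
- by rewrite bigcup_const.
- move=> _ [s [V [mV ->]]]; rewrite -cylinder_undup.
  by apply: h => //; exact: undup_uniq.
- by move=> k; rewrite [ltLHS]probability_setT ltry.
Qed.

Definition set_clock (i : I) (s : R) (w : clock_space) : clock_space :=
  fun j => if j == i then s else w j.

End clock_space.

Section iid_clocks.
Local Open Scope ereal_scope.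
Variables (R : realType) (I : eqType) (Q : probability (clock_space R I) R).
Hypothesis Qiid : forall s V, uniq s -> (forall i, measurable (V i)) ->
  Q (cylinder s V) = \prod_(i <- s) expo1 R (V i).

Lemma measurable_set_clock (i : I) : measurable_fun [set: measurableTypeR R * clock_space R I]
  (fun x => set_clock i x.1 x.2).
Proof.
apply: measurable_fun_coord => j; rewrite /set_clock.
case: (j == i); first exact: measurable_fst.
exact: (measurableT_comp (@measurable_coord R I j)
  (@measurable_snd _ _ (measurableTypeR R) (clock_space R I))).
Qed.

(** Replacing one coordinate by an independent exponential variable preserves
    the probability of every cylinder, hence the law of all clocks.  In this
    way a single clock can be integrated out without writing the law as an
    infinite product. *)
Lemma resample_clock (i : I) (F : clock_space R I -> \bar R) :
  measurable_fun [set: clock_space R I] F -> (forall w, 0 <= F w) ->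
  \int[Q]_w F w = \int[expo1 R]_s \int[Q]_w F (set_clock i s w).
Proof.
move=> mF F0.
(* The law of the pair (new duration, old clocks), pushed forward by the
   replacement, is compared with Q on cylinders. *)
pose U (x : measurableTypeR R * clock_space R I) := set_clock i x.1 x.2.
have mU : measurable_fun setT U := measurable_set_clock i.
pose UQ := distribution (expo1 R \x Q)
  (HB.pack U (isMeasurableFun.Build _ _ _ _ _ mU) : {mfun _ >-> _}).
have UE A : measurable A -> Q A = UQ A.
  apply: clock_space_unique => s V us mV; rewrite Qiid//.
  rewrite /UQ /distribution/= /pushforward/=.
  have [iS|iS] := boolP (i \in s).
    rewrite (_ : _ @^-1` _ = V i `*` cylinder (rem i s) V).
      rewrite [RHS]product_measure1E;
        [|exact: mV|exact: measurable_cylinder].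
      rewrite (big_rem i iS)/=; congr (_ * _); apply/esym/Qiid => //.
      exact: rem_uniq.
    apply/seteqP; split => -[x w] /=.
      move=> h; split => [|j]; first by have := h _ iS; rewrite /U/set_clock/= eqxx.
      rewrite mem_rem_uniq// inE/= => /andP[/negbTE ji js].
      by have := h _ js; rewrite /U/set_clock/= ji.
    move=> [h1 h2] j js; rewrite /U/set_clock/=; case: eqP => [->//|/eqP ji].
    by apply: h2; rewrite mem_rem_uniq// inE/= ji.
  rewrite (_ : _ @^-1` _ = setT `*` cylinder s V).
    rewrite [RHS]product_measure1E//; last exact: measurable_cylinder.
    rewrite -Qiid// -[LHS]mul1e; congr (_ * _).
    by rewrite -(@probability_setT _ _ _ (expo1 R)).
  have ne j : j \in s -> (j == i) = false.
    by move=> js; apply/eqP => ji; rewrite -ji js in iS.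
  apply/seteqP; split => -[x w] /=.
    by move=> h; split => // j js; have := h _ js; rewrite /U/set_clock/= ne.
  by move=> [_ h] j js; rewrite /U/set_clock/= ne//; exact: h.
rewrite (eq_measure_integral _ (fun A mA _ => UE A mA)).
rewrite ge0_integral_distribution// fubini_tonelli1//.
- by apply: measurableT_comp.
- by move=> x; exact: F0.
Qed.

End iid_clocks.

(** * The first of finitely many clocks *)

Lemma integral_expR_scale (R : realType) (c : R) : 0 < c ->
  (\int[lebesgue_measure]_(s in `]0%R, +oo[) (expR (- (c * s)))%:E = (c^-1)%:E)%E.
Proof.
move=> c0.
have me : measurable_fun [set: R] (fun s => (expR (- (c * s)))%:E).
  apply/measurable_EFinP; apply: measurableT_comp => //.
  by apply: measurableT_comp => //; exact: measurable_funM.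
have := integral_exponential_pdf c0.
rewrite (_ : (\int[_]_x _ = c%:E * \int[lebesgue_measure]_(s in `]0%R, +oo[)
    (expR (- (c * s)))%:E)%E) => [h|].
  by rewrite -[LHS]mul1e -(mulVf (lt0r_neq0 c0)) EFinM -muleA h mule1.
rewrite integral_itv_obnd_cbnd; last exact: measurable_funTS.
rewrite -ge0_integralZl ?lee_fin ?(ltW c0)//; last exact: measurable_funTS.
rewrite [RHS]integral_mkcond; apply: eq_integral => x _.
rewrite patchE /exponential_pdf patchE; case: ifPn => // _.
by rewrite -EFinM mulNr.
Qed.

Section first_clock.
Local Open Scope ereal_scope.
Variables (R : realType) (I : eqType) (Q : probability (clock_space R I) R).
Hypothesis Qiid : forall s V, uniq s -> (forall i, measurable (V i)) ->
  Q (cylinder s V) = \prod_(i <- s) expo1 R (V i).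
Local Notation mu := (@lebesgue_measure R).
Implicit Types (F : clock_space R I -> \bar R) (i j : I) (l : seq I).

Lemma measurable_fun_resampled i F : measurable_fun setT F -> (forall w, 0 <= F w) ->
  measurable_fun [set: R] (fun s => \int[Q]_w F (set_clock i s w)).
Proof.
move=> mF F0.
apply: (@measurable_fun_fubini_tonelli_F _ _ (measurableTypeR R) (clock_space R I) R Q
  (fun x => F (set_clock i x.1 x.2))) => //.
exact: measurableT_comp (measurable_set_clock i).
Qed.

Lemma measurable_set_clock1 i (f : clock_space R I -> R) : measurable_fun setT f ->
  measurable_fun setT (fun w => set_clock i (f w) w).
Proof.
move=> mf; apply: measurable_fun_coord => j; rewrite /set_clock.
by case: (j == i) => //; exact: measurable_coord.
Qed.

(** Given that clock j still runs at time s, its residual duration is a fresh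
    exponential independent of the other clocks; this is the lack of memory of
    a single exponential, transported by resampling. *)
Lemma clock_memoryless j s F : (0 <= s)%R ->
  measurable_fun setT F -> (forall w, 0 <= F w) ->
  \int[Q]_w ((s < w j)%R%:R%:E * F w) =
  (expR (- s))%:E * \int[Q]_w F (set_clock j (w j + s)%R w).
Proof.
move=> s0 mF F0.
have mj : measurable_fun [set: clock_space R I] (fun w => w j) := measurable_coord j.
have mw : measurable_fun [set: clock_space R I] (fun w => (s < w j)%R%:R%:E : \bar R).
  by apply: measurable_bool_indic; exact: measurable_fun_ltr.
rewrite (resample_clock Qiid j); last 2 first.
- exact: emeasurable_funM.
- by move=> w; rewrite mule_ge0// lee_fin.
transitivity (\int[expo1 R]_x ((s < x)%R%:R%:E * \int[Q]_w F (set_clock j x w))).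
  apply: eq_integral => x _.
  have <- : \int[Q]_w ((s < x)%R%:R%:E * F (set_clock j x w)) =
      (s < x)%R%:R%:E * \int[Q]_w F (set_clock j x w).
    rewrite ge0_integralZl ?lee_fin//.
    exact: measurableT_comp (measurable_set_clock1 _ _).
  by apply: eq_integral => w _; rewrite /set_clock eqxx.
rewrite expo1_memoryless//; last 2 first.
- exact: measurable_fun_resampled.
- by move=> x; exact: integral_ge0.
congr (_ * _).
have mFs : measurable_fun setT
    (fun w : clock_space R I => F (set_clock j (w j + s)%R w)).
  apply: measurableT_comp => //; apply: measurable_set_clock1.
  exact: measurable_funD.
rewrite [RHS](resample_clock Qiid j mFs (fun=> F0 _)).
apply: eq_integral => x _; apply: eq_integral => w _.
congr F; apply/funext => k; rewrite /set_clock.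
by case: (k == j); rewrite ?eqxx.
Qed.

(** A point w of the clock space is read here as the residual durations at
    time s, when clock i has just rung and those of l still run: a duration
    counted from time 0 exceeds its residual by s, and the clocks outside
    i :: l have not been started. *)
Definition delay_clocks i l (s : R) (w : clock_space R I) : clock_space R I :=
  fun j => if j == i then s else if j \in l then (w j + s)%R else w j.

Lemma measurable_delay_clocks i l s : measurable_fun setT (delay_clocks i l s).
Proof.
apply: measurable_fun_coord => j; rewrite /delay_clocks.
case: (j == i) => //; case: (j \in l); last exact: measurable_coord.
by apply: measurable_funD => //; exact: measurable_coord.
Qed.

Lemma measurable_all_lt i l : measurable_fun [set: clock_space R I]
   (fun w => (all (fun j => w i < w j)%R l)%:R%:E : \bar R).
Proof.
apply: measurable_bool_indic; elim: l => [|j l IHl] //=.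
apply: measurable_and => //; apply: measurable_fun_ltr; exact: measurable_coord.
Qed.

(** By induction on l: each clock that has to outlast s contributes a factor
    exp (- s) and restarts at s, by the lack of memory; integrating out clock i
    contributes the remaining factor, its density at s. *)
Lemma first_clock i l F : uniq (i :: l) ->
  measurable_fun setT F -> (forall w, 0 <= F w) ->
  \int[Q]_w ((all (fun j => w i < w j)%R l)%:R%:E * F w) =
  \int[mu]_(s in `]0%R, +oo[)
    ((expR (- ((size l).+1%:R * s)))%:E * \int[Q]_w F (delay_clocks i l s w)).
Proof.
elim: l F => [|j l IHl] F /=.
  move=> _ mF F0; under eq_integral do rewrite mul1e.
  rewrite (resample_clock Qiid i mF F0) (integral_expo1 (measurable_fun_resampled i mF F0)).
    by apply: eq_integral => s _; rewrite muleC mul1r.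
  by move=> x; exact: integral_ge0.
rewrite inE negb_or => /andP[/andP[ij il] /andP[jl ul]] mF F0.
have mj : measurable_fun [set: clock_space R I] (fun w => (w i < w j)%R%:R%:E : \bar R).
  by apply: measurable_bool_indic; apply: measurable_fun_ltr; exact: measurable_coord.
transitivity (\int[Q]_w ((all (fun j => w i < w j)%R l)%:R%:E *
    ((w i < w j)%R%:R%:E * F w))).
  apply: eq_integral => w _; rewrite muleA; congr (_ * _).
  by rewrite -EFinM -natrM mulnb andbC.
rewrite IHl; last 3 first.
- by rewrite /= il.
- exact: emeasurable_funM.
- by move=> w; rewrite mule_ge0// lee_fin.
apply: eq_integral => s; rewrite inE/= in_itv/= andbT => s0.
rewrite -[in RHS](natr1 (size l).+1) mulrDl mul1r opprD expRD EFinM -muleA.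
congr (_ * _).
transitivity (\int[Q]_w ((s < w j)%R%:R%:E * F (delay_clocks i l s w))).
  apply: eq_integral => w _; rewrite {1 2}/delay_clocks eqxx.
  by rewrite [j == i]eq_sym (negbTE ij) (negbTE jl).
rewrite clock_memoryless ?ltW//; last first.
  by apply: measurableT_comp => //; exact: measurable_delay_clocks.
congr (_ * _); apply: eq_integral => w _; congr F; apply/funext => k.
rewrite /delay_clocks /set_clock inE; case: (eqVneq k i) => // ki.
by case: (eqVneq k j) => [->|//]; rewrite (negbTE jl).
Qed.

(** Strict inequalities, so that at most one clock of L is first. *)
Definition is_first i L (w : clock_space R I) := all (fun j => w i < w j)%R (rem i L).

(** At most one clock is strictly first, and each of the N clocks is so with
    probability 1/N by [first_clock].  The probabilities add up to 1, so ties
    are negligible. *)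
Lemma integral_first_clock L F : uniq L -> (0 < size L)%N ->
  measurable_fun setT F -> (forall w, 0 <= F w) ->
  \int[Q]_w F w = \sum_(i <- L) \int[Q]_w ((is_first i L w)%:R%:E * F w).
Proof.
move=> uL L0 mF F0.
have mf i : measurable_fun setT (fun w => (is_first i L w)%:R%:E : \bar R).
  exact: measurable_all_lt.
(* S is the indicator of the absence of ties. *)
pose S w := \sum_(i <- L) (is_first i L w)%:R%:E : \bar R.
have mS : measurable_fun setT S by exact: emeasurable_sum.
have S01 w : S w = 0 \/ S w = 1.
  have [/hasP[i iL fi]|/hasPn h] := boolP (has (fun i => is_first i L w) L); last first.
    by left; rewrite /S big_seq big1// => i /h /negbTE ->.
  right; rewrite /S (big_rem i iL)/= fi big_seq big1 ?adde0// => j jL.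
  case: (boolP (is_first j L w)) => // /allP fj.
  have jLi : j \in L by exact: mem_rem jL.
  have ij : i != j by apply: contraTneq jL => <-; rewrite mem_rem_uniq// inE eqxx.
  have := fj i; rewrite mem_rem_uniq// inE ij iL => /(_ isT).
  by move/allP: fi => /(_ j jL) /lt_trans /[apply]; rewrite ltxx.
have S0 w : 0 <= S w by case: (S01 w) => ->.
have mass i : i \in L ->
    \int[Q]_w (is_first i L w)%:R%:E = ((size L)%:R^-1)%:E.
  move=> iL; transitivity (\int[Q]_w ((is_first i L w)%:R%:E * (fun=> 1) w)).
    by apply: eq_integral => w _; rewrite mule1.
  rewrite first_clock//; last by rewrite /= mem_rem_uniq// inE eqxx rem_uniq.
  rewrite -integral_expR_scale ?ltr0n// size_rem// prednK//.
  apply: eq_integral => s _.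
  by rewrite integral_cst// [X in _ * X]mul1e [X in _ * X]probability_setT mule1.
have intS : \int[Q]_w S w = 1.
  rewrite ge0_integral_sum//.
  under eq_big_seq => i iL do rewrite (mass i iL).
  rewrite sumEFin big_const_seq count_predT iter_addr addr0.
  by rewrite -[X in X%:E]mulr_natr mulVf// pnatr_eq0 -lt0n.
pose A := S @^-1` [set 1].
have mA : measurable A by rewrite -[A]setTI; exact: mS.
have SA w : S w = (\1_A w)%:E.
  rewrite indicE; case: (S01 w) => Sw; last by rewrite mem_set.
  rewrite Sw memNset//= /A/= Sw => /eqP.
  by rewrite eqe eq_sym oner_eq0.
have QA : Q (~` A) = 0.
  rewrite probability_setC// [Q A](_ : _ = 1) ?subee// -intS.
  by under eq_integral do rewrite SA; rewrite integral_indic// setIT.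
transitivity (\int[Q]_w (S w * F w)).
  apply: ae_eq_integral => //; first exact: emeasurable_funM.
  exists (~` A); split => // [|w /= h Aw]; first exact: measurableC.
  by apply: h => _; rewrite Aw mul1e.
rewrite -ge0_integral_sum//.
- apply: eq_integral => w _; rewrite /S ge0_sume_distrl//.
- by move=> i; exact: emeasurable_funM.
- by move=> i w _; rewrite mule_ge0// lee_fin.
Qed.

End first_clock.

(** * One draw of the urn *)

Section urn_combinatorics.
Local Open Scope nat_scope.

Lemma map_set_nth (X Y : Type) (f : X -> Y) x0 y0 (s : seq X) i x :
  i <= size s -> map f (set_nth x0 s i x) = set_nth y0 (map f s) i (f x).
Proof. by elim: s i => [|z s IHs] [|i]//= ?; rewrite IHs. Qed.

Lemma uniq_set_nth (X : eqType) x0 (s : seq X) i x : i < size s ->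
  uniq s -> x \notin s -> uniq (set_nth x0 s i x).
Proof.
elim: s i => [//|z s IHs] [|i]/= ls /andP[zs us]; rewrite inE negb_or => /andP[xz xs].
  by rewrite xs.
rewrite IHs// andbT; apply: contra zs => zs'.
have : z \in rcons s x.
  elim: s i ls zs' {IHs us xs} => [//|y s IHs] [|i]/= ls; rewrite !inE.
    by rewrite mem_rcons inE => /predU1P[->|->]; rewrite ?eqxx ?orbT.
  by case/predU1P => [->|/(IHs _ ls)->]; rewrite ?eqxx ?orbT.
by rewrite mem_rcons inE eq_sym (negbTE xz).
Qed.

Lemma mem_set_nth (X : eqType) x0 (s : seq X) i x y : i < size s -> uniq s ->
  y \in set_nth x0 s i x -> y = x \/ (y \in s) && (y != nth x0 s i).
Proof.
elim: s i => [//|z s IHs] [|i]/= ls /andP[zs us]; rewrite !inE.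
  case/predU1P => [->|ys]; [by left|right].
  by rewrite ys orbT/=; apply: contraNneq zs => <-.
case/predU1P => [->|/(IHs _ ls us)[->|/andP[ys yi]]]; [right|by left|right].
  by rewrite eqxx/=; apply: contraNneq zs => ->; exact: mem_nth.
by rewrite ys orbT.
Qed.

Section replace_balls.
Variables (A : 'M[int]_2) (keep : seq ('I_2 * nat) -> 'I_2 -> nat -> nat -> bitseq).

(** The effect of a draw on the balls of each colour, for balls of any type.  It
    commutes with maps ([map_replace_balls]); hence an urn can be run on labels
    or on random variables, and the ringing times are recovered afterwards. *)
Definition replace_balls (X : Type) (x0 : X) (h : seq ('I_2 * nat))
    (fresh : 'I_2 -> nat -> X) (c : 'I_2) (i : nat) (l : 'I_2 -> seq X) (e : 'I_2) : seq X :=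
  let back := if e == c then set_nth x0 (l c) i (fresh c 0) else l e in
  match A c e with
  | Posz k => back ++ mkseq (fun j => fresh e j.+1) k
  | Negz k => mask (keep ((c, i) :: h) e (size back) k.+1) back
  end.

Lemma map_replace_balls (X Y : Type) (f : X -> Y) x0 y0 h fresh c i l e : i <= size (l c) ->
  map f (replace_balls x0 h fresh c i l e) =
  replace_balls y0 h (fun e k => f (fresh e k)) c i (fun e => map f (l e)) e.
Proof.
move=> il; rewrite /replace_balls.
have backE : map f (if e == c then set_nth x0 (l c) i (fresh c 0) else l e) =
    if e == c then set_nth y0 (map f (l c)) i (f (fresh c 0)) else map f (l e).
  by case: (e == c); rewrite ?(map_set_nth _ _ y0).
case: (A c e) => k; first by rewrite map_cat backE -map_comp.
by rewrite map_mask -backE size_map.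
Qed.

Lemma eq_replace_balls (X : Type) (x0 : X) h fresh fresh' c i l l' :
  (forall e k, fresh e k = fresh' e k) -> (forall e, l e = l' e) ->
  replace_balls x0 h fresh c i l = replace_balls x0 h fresh' c i l'.
Proof.
move=> ff ll; congr replace_balls; apply/funext => e => //.
by apply/funext => k.
Qed.

Variable R : realType.
Implicit Types (u : urn R) (E : nat * 'I_2 * nat -> R).

Definition drawn_time u := earliest (rings u white ++ rings u blue).
Definition drawn_colour u := if drawn_time u \in rings u white then white else blue.
Definition drawn_ball u := (drawn_colour u, index (drawn_time u) (rings u (drawn_colour u))).

Lemma drawE E u : draw A keep E u =
  let: (c, i) := drawn_ball u in
  Urn (drawn_time u)
    (replace_balls 0%R (draws u)
      (fun e k => (drawn_time u + E ((size (draws u)).+1, e, k))%R) c i (rings u))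
    ((c, i) :: draws u).
Proof. by []. Qed.

Lemma size_draws_draw E u : size (draws (draw A keep E u)) = (size (draws u)).+1.
Proof. by []. Qed.

Lemma eq_draw E E' u :
  (forall e k, E ((size (draws u)).+1, e, k) = E' ((size (draws u)).+1, e, k)) ->
  draw A keep E u = draw A keep E' u.
Proof.
move=> EE; rewrite !drawE; case: drawn_ball => c i; congr Urn.
by apply: eq_replace_balls => // e k; rewrite EE.
Qed.

(** From an urn with m draws in its history, n further draws only start clocks
    of levels above m. *)
Lemma eq_iter_draw n E E' u : (forall m e k, size (draws u) < m -> E (m, e, k) = E' (m, e, k)) ->
  iter n (draw A keep E) u = iter n (draw A keep E') u.
Proof.
elim: n u => [//|n IHn] u EE; rewrite !iterSr (eq_draw (E' := E')).
  by apply: IHn => m e k; rewrite size_draws_draw => /ltnW; exact: EE.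
by move=> e k; exact: EE.
Qed.

Lemma earliest_mem (s : seq R) : 0 < size s -> earliest s \in s.
Proof.
case: s => // x s _; rewrite /earliest /=.
have : forall (t : seq R) (y : R), (\big[Num.min/y]_(r <- t) r)%R \in y :: t.
  elim=> [|z t IHt] y; first by rewrite big_nil inE.
  rewrite big_cons minEle; case: ifP => _; first by rewrite !inE eqxx orbT.
  by have := IHt y; rewrite !inE => /orP[->|->]; rewrite ?orbT.
by move=> /(_ (x :: s) x); rewrite !inE orbA orbb.
Qed.

Lemma earliest_le (s : seq R) y : y \in s -> (earliest s <= y)%R.
Proof. by move=> ys; rewrite /earliest; exact: ge_bigmin_seq. Qed.

Lemma lt_earliest (s : seq R) y : 0 < size s ->
  (y < earliest s)%R = all (fun r => y < r)%R s.
Proof.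
move=> s0; apply/idP/allP => [h r /earliest_le|->//]; first exact: lt_le_trans.
exact: earliest_mem.
Qed.

Lemma earliest_first (s : seq R) y : y \in s -> all (fun z => y <= z)%R s -> earliest s = y.
Proof.
move=> ys /allP h; apply/eqP; rewrite eq_le earliest_le//= h// earliest_mem//.
by case: s ys {h}.
Qed.

End replace_balls.

Section labelled_urn.
Variables (A : 'M[int]_2) (keep : seq ('I_2 * nat) -> 'I_2 -> nat -> nat -> bitseq).
Variable R : realType.
Local Notation label := (nat * 'I_2 * nat)%type.
Implicit Types (l : 'I_2 -> seq label) (h : seq ('I_2 * nat)) (w : label -> R).

(** The urn at time s0 in which the ball labelled y has residual duration w y. *)
Definition labelled_urn (s0 : R) l h w : urn R :=
  Urn s0 (fun e => map (fun y => s0 + w y)%R (l e)) h.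

(** The level of a label, its first component, is the number of the draw that
    started the clock; as it is at most the number of past draws, the labels
    created by later draws are new. *)
Definition well_labelled l h := forall e,
  uniq (l e) /\ {in l e, forall y : label, y.1.1 <= size h /\ y.1.2 = e}.

Definition all_labels l := l white ++ l blue.

Definition next_draws l h (x : label) := (x.1.2, index x (l x.1.2)) :: h.

Definition next_labels l h (x : label) : 'I_2 -> seq label :=
  replace_balls A keep x h (fun e k => ((size h).+1, e, k)) x.1.2 (index x (l x.1.2)) l.

Lemma colourP (e : 'I_2) : e = white \/ e = blue.
Proof. by case: e => -[|[|//]] i; [left|right]; exact: val_inj. Qed.

Lemma mem_all_labels l h x : well_labelled l h -> x \in all_labels l -> x \in l x.1.2.
Proof.
move=> wf; rewrite mem_cat => /orP[] xl.
  by have [_ /(_ _ xl)[_ ->]] := wf white.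
by have [_ /(_ _ xl)[_ ->]] := wf blue.
Qed.

Lemma mem_labels l e x : x \in l e -> x \in all_labels l.
Proof. by rewrite mem_cat; case: (colourP e) => -> ->; rewrite ?orbT. Qed.

Lemma uniq_all_labels l h : well_labelled l h -> uniq (all_labels l).
Proof.
move=> wf; have [uw lw] := wf white; have [ub lb] := wf blue.
rewrite cat_uniq uw ub andbT; apply/hasPn => x xb; apply/negP => xw.
by have [_] := lw _ xw; have [_ ->] := lb _ xb.
Qed.

Lemma mem_next_labels l h x e y : well_labelled l h -> x \in all_labels l ->
  y \in next_labels l h x e ->
  (y \in l e) && (y != x) \/ (exists k, y = ((size h).+1, e, k)).
Proof.
move=> wf xL; have xl := mem_all_labels wf xL; rewrite /next_labels /replace_balls.
set back := if _ then _ else _.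
have mb : y \in back -> (y \in l e) && (y != x) \/ (exists k, y = ((size h).+1, e, k)).
  rewrite /back; case: eqVneq => [->|ex yl].
    move=> /mem_set_nth; rewrite index_mem xl => /(_ isT (wf _).1)[->|].
      by right; exists 0.
    by rewrite nth_index//; left.
  left; rewrite yl/=; apply: contraNneq ex => <-.
  by have [_ /(_ _ yl)[_ ->]] := wf e.
case: (A _ _) => k; last by move=> /mem_mask/mb.
by rewrite mem_cat => /orP[/mb//|/mapP[j _ ->]]; right; exists j.+1.
Qed.

Lemma well_labelled_next l h x : well_labelled l h -> x \in all_labels l ->
  well_labelled (next_labels l h x) (next_draws l h x).
Proof.
move=> wf xL e; have xl := mem_all_labels wf xL; split; last first.
  move=> y /(mem_next_labels wf xL)[/andP[yl _]|[k ->//]].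
  by have [_ /(_ _ yl)[+ ->]] := wf e => /leqW.
rewrite /next_labels /replace_balls.
have fresh e' k : ((size h).+1, e, k) \notin l e'.
  by apply/negP => /(proj2 (wf e'))[/=]; rewrite ltnn.
set back := if _ then _ else _.
have ub : uniq back.
  rewrite /back; case: eqVneq => [ex|_]; last exact: (wf e).1.
  by apply: uniq_set_nth; rewrite ?index_mem//; [exact: (wf _).1|rewrite -ex fresh].
case: (A _ _) => k; last exact: mask_uniq.
rewrite cat_uniq ub map_inj_uniq ?iota_uniq ?andbT; last by move=> i j [].
apply/hasPn => _ /mapP[j _ ->]; rewrite /back; case: eqVneq => [ex|_] //.
apply/negP => /mem_set_nth; rewrite index_mem xl => /(_ isT (wf _).1)[//|].
by rewrite ex in fresh *; rewrite (negbTE (fresh _ _)).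
Qed.

Lemma index_map_first (X Y : eqType) (f : X -> Y) (s : seq X) x : x \in s ->
  {in s, forall y, f y = f x -> y = x} -> index (f x) (map f s) = index x s.
Proof.
elim: s => [//|y s IHs] xs fx /=; have [->|yx] := eqVneq y x; first by rewrite eqxx.
rewrite ifN; last by apply: contraNneq yx => /fx -> //; rewrite inE eqxx.
congr S; apply: IHs; first by move: xs; rewrite inE eq_sym (negbTE yx).
by move=> z zs; apply: fx; rewrite inE zs orbT.
Qed.

(** The urn after the draw of the ball labelled x, whether or not its clock is
    first.  Old balls keep ringing times counted from s0, whereas the balls with
    new labels are started at the epoch s0 + w x.  Unlike the true draw, it is
    measurable in w for a fixed x without case distinction. *)
Definition forced_draw (s0 : R) l h x w : urn R :=
  Urn (s0 + w x)%R (fun e => map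
    (fun y => if y \in all_labels l then s0 + w y else s0 + w x + w y)%R
    (next_labels l h x e)) (next_draws l h x).

Lemma is_first_neq L (w : label -> R) x y : uniq L -> is_first x L w -> y \in L ->
  y != x -> (w x < w y)%R.
Proof. by move=> uL /allP fx yL yx; apply: fx; rewrite mem_rem_uniq// inE yx. Qed.

Lemma draw_first s0 l h x w : well_labelled l h -> x \in all_labels l ->
  is_first x (all_labels l) w ->
  draw A keep w (labelled_urn s0 l h w) = forced_draw s0 l h x w.
Proof.
move=> wf xL fx; have xl := mem_all_labels wf xL; have uL := uniq_all_labels wf.
have lt_x y : y \in all_labels l -> y != x -> (w x < w y)%R by exact: is_first_neq.
have timeE : drawn_time (labelled_urn s0 l h w) = (s0 + w x)%R.
  rewrite /drawn_time /= -map_cat; apply: earliest_first; first exact: map_f.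
  apply/allP => _ /mapP[y yL ->]; rewrite lerD2l.
  by have [->//|yx] := eqVneq y x; apply/ltW/lt_x.
have inj_x y : y \in all_labels l -> (s0 + w y)%R = (s0 + w x)%R -> y = x.
  move=> yL /addrI wyx; apply/eqP; apply: contraT => /(lt_x _ yL).
  by rewrite wyx ltxx.
have colE : drawn_colour (labelled_urn s0 l h w) = x.1.2.
  rewrite /drawn_colour timeE /=; case: ifPn => [/mapP[y yw /esym/inj_x yx]|].
    rewrite -yx ?(mem_labels yw)//.
    by have [_ /(_ _ yw)[_ ->]] := wf white.
  case: (colourP x.1.2) => [xw|->//] /mapP[]; exists x => //.
  by rewrite -xw.
have ballE : drawn_ball (labelled_urn s0 l h w) = (x.1.2, index x (l x.1.2)).
  rewrite /drawn_ball colE timeE /=; congr pair.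
  apply: (index_map_first (f := fun y => s0 + w y)%R) => // y yl.
  by apply: inj_x; exact: mem_labels yl.
rewrite drawE ballE timeE /forced_draw; congr Urn.
apply/funext => e; rewrite /next_labels (map_replace_balls _ _ _ _ 0%R); last first.
  by rewrite ltnW// index_mem.
apply: (congr1 (fun Z : 'I_2 -> seq R => Z e)).
apply: eq_replace_balls => [e' k|e'] /=.
  rewrite ifN//; apply/negP => /(mem_all_labels wf)/=.
  by move=> /(proj2 (wf e'))[/=]; rewrite ltnn.
by apply/eq_in_map => y /mem_labels ->.
Qed.

(** With the clocks read as residual durations at the epoch, the urn after the
    draw of x is again a labelled urn, restarted at the epoch: old balls have
    residual duration w y, and so have the new ones. *)
Lemma forced_draw_delay s0 l h x s w : well_labelled l h -> x \in all_labels l ->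
  forced_draw s0 l h x (delay_clocks x (rem x (all_labels l)) s w) =
  labelled_urn (s0 + s)%R (next_labels l h x) (next_draws l h x) w.
Proof.
move=> wf xL; have uL := uniq_all_labels wf.
rewrite /forced_draw /labelled_urn {1}/delay_clocks eqxx; congr Urn.
apply/funext => e; apply/eq_in_map => y /(mem_next_labels wf xL).
rewrite /delay_clocks eqxx => -[/andP[yl yx]|[k ->]].
  by rewrite (mem_labels yl) (negbTE yx) mem_rem_uniq// inE yx (mem_labels yl)/= addrA addrAC.
have yL : ((size h).+1, e, k) \notin all_labels l.
  apply/negP => /(mem_all_labels wf)/=.
  by move=> /(proj2 (wf e))[/=]; rewrite ltnn.
rewrite (negbTE yL) mem_rem_uniq// inE (negbTE yL) andbF.
by rewrite ifN//; apply: contraNneq yL => ->.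
Qed.

(** Later draws use clocks of higher levels only, which [delay_clocks] leaves
    unchanged. *)
Lemma iter_draw_delay n l h x s w u : well_labelled l h -> x \in all_labels l ->
  size h < size (draws u) ->
  iter n (draw A keep (delay_clocks x (rem x (all_labels l)) s w)) u =
  iter n (draw A keep w) u.
Proof.
move=> wf xL hu; apply: eq_iter_draw => m e k um; rewrite /delay_clocks.
have yL : (m, e, k) \notin all_labels l.
  apply/negP => /(mem_all_labels wf)/=.
  move=> /(proj2 (wf e))[/=] mh _; by have := leq_trans (ltn_trans hu um) mh; rewrite ltnn.
rewrite mem_rem_uniq ?(uniq_all_labels wf)// inE (negbTE yL) andbF.
by rewrite ifN//; apply: contraNneq yL => ->.
Qed.

End labelled_urn.

End urn_combinatorics.

(** * Measurability of the urn and means after a given number of draws *)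

Section measurability.
Context d (T : measurableType d) (R : realType).

Lemma measurable_fun_glue (K : countType) (p : T -> K) (G : K -> T -> \bar R) :
  (forall k, measurable [set w | p w = k]) ->
  (forall k, measurable_fun setT (G k)) ->
  measurable_fun setT (fun w => G (p w) w).
Proof.
move=> mp mG _ B mB; rewrite setTI.
rewrite (_ : _ @^-1` _ = \bigcup_k ([set w | p w = k] `&` (G k @^-1` B))).
  apply: countable_bigcupT_measurable => // k; apply: measurableI => //.
  by rewrite -[X in measurable X]setTI; exact: mG.
apply/seteqP; split => [w /= Bw|w [k _ [/= <-]]//].
by exists (p w).
Qed.

Definition mk_mfun (f : T -> R) (mf : measurable_fun setT f) : {mfun T >-> R} :=
  HB.pack f (isMeasurableFun.Build _ _ _ _ _ mf).

Definition values (w : T) (s : seq {mfun T >-> R}) : seq R := map (fun f : {mfun T >-> R} => f w) s.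

Lemma measurable_earliest (s : seq {mfun T >-> R}) :
  measurable_fun setT (fun w => earliest (values w s)).
Proof.
rewrite /earliest.
have mh : measurable_fun setT (fun w => head 0 (values w s)).
  by case: s => [|f s] /=; [exact: measurable_cst|exact: measurable_funPT].
have key (g : T -> R) : measurable_fun setT g ->
    measurable_fun setT (fun w => \big[Num.min/g w]_(r <- values w s) r).
  elim: s {mh} g => [|f s IHs] g mg /=; first by under eq_fun do rewrite big_nil.
  under eq_fun do rewrite big_cons.
  by apply: measurable_minr; [exact: measurable_funPT|exact: IHs].
exact: key mh.
Qed.

Lemma measurable_mem (s : seq {mfun T >-> R}) (g : T -> R) : measurable_fun setT g ->
  measurable_fun setT (fun w => g w \in values w s).
Proof.
move=> mg; elim: s => [|f s IHs] /=; first exact: measurable_cst.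
under eq_fun do rewrite inE.
apply: measurable_or => //; apply: measurable_fun_eqr => //.
Qed.

Lemma measurable_index (s : seq {mfun T >-> R}) (g : T -> R) : measurable_fun setT g ->
  measurable_fun setT (fun w => index (g w) (values w s)).
Proof.
move=> mg; elim: s => [|f s IHs] /=; first exact: measurable_cst.
apply: measurable_fun_ifT => //; first exact: measurable_fun_eqr.
exact: (@measurableT_comp _ _ _ _ _ _ S).
Qed.

End measurability.

(** Urns carry no sigma-algebra.  A functional counts as measurable if it becomes
    so when the epoch and the ringing times are random variables, in fixed
    numbers and with a fixed history of draws. *)
Definition urn_measurable (R : realType) (F : urn R -> \bar R) :=
  forall d (T : measurableType d) (S : {mfun T >-> R})
    (l : 'I_2 -> seq {mfun T >-> R}) (h : seq ('I_2 * nat)),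
  measurable_fun setT (fun w => F (Urn (S w) (fun e => values w (l e)) h)).

Section measurable_iter_draw.
Variables (A : 'M[int]_2) (keep : seq ('I_2 * nat) -> 'I_2 -> nat -> nat -> bitseq).
Context (R : realType) d (T : measurableType d).
Variables (E : nat * 'I_2 * nat -> {mfun T >-> R}) (F : urn R -> \bar R).
Hypothesis mF : urn_measurable F.

Lemma measurable_drawn_ball (S : T -> R) (l : 'I_2 -> seq {mfun T >-> R}) h p :
  measurable [set w | drawn_ball (Urn (S w) (fun e => values w (l e)) h) = p].
Proof.
case: p => c i.
pose tau w := earliest (values w (l white ++ l blue)).
have mtau : measurable_fun setT tau by exact: measurable_earliest.
have tauE w : drawn_time (Urn (S w) (fun e => values w (l e)) h) = tau w.
  by rewrite /tau /values map_cat.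
pose b w := tau w \in values w (l white).
have mb : measurable_fun setT b by exact: measurable_mem.
rewrite (_ : [set _ | _] = (b @^-1` [set c == white]) `&`
    ((fun w => index (tau w) (values w (l c))) @^-1` [set i])).
  apply: measurableI; rewrite -[X in measurable X]setTI; first exact: mb.
  exact: (measurable_index (l c) mtau).
apply/seteqP; split => w /=; rewrite /drawn_ball /drawn_colour tauE /= -/(b w).
  by case: (b w) => -[<- <-].
by case: (colourP c) => -> /= [-> <-].
Qed.

(** By induction on n: on the event that a given ball is drawn, the urn after the
    draw is once more given by random variables, in fixed numbers, and there are
    countably many such events. *)
Lemma measurable_iter_draw n (S : {mfun T >-> R}) (l : 'I_2 -> seq {mfun T >-> R}) h :
  measurable_fun setT (fun w => F (iter n (draw A keep (fun y => E y w))
    (Urn (S w) (fun e => values w (l e)) h))).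
Proof.
elim: n S l h => [|n IHn] S l h; first exact: mF.
pose p w := drawn_ball (Urn (S w) (fun e => values w (l e)) h).
pose tau := mk_mfun (measurable_earliest (l white ++ l blue)).
pose G (k : 'I_2 * nat) w := F (iter n (draw A keep (fun y => E y w))
  (Urn (tau w) (fun e => values w
    (replace_balls A keep 0 h (fun e k => tau + E ((size h).+1, e, k)) k.1 k.2 l e)) (k :: h))).
rewrite (_ : (fun w => _) = (fun w => G (p w) w)).
  apply: measurable_fun_glue => [k|k]; first exact: measurable_drawn_ball.
  exact: IHn.
apply/funext => w; rewrite iterSr drawE -/(p w) /G.
have pE : ((p w).2 <= size (l (p w).1))%N.
  by rewrite -(size_map (fun f : {mfun T >-> R} => f w)) index_size.
case: (p w) pE => c i /= il; congr (F (iter _ _ (Urn _ _ _))).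
  by rewrite /drawn_time/= /values -map_cat.
apply/funext => e; rewrite /values (map_replace_balls _ _ _ _ 0)//.
apply: (congr1 (fun Z : 'I_2 -> seq R => Z e)); apply: eq_replace_balls => //= e' k.
by rewrite /drawn_time/= /values -map_cat.
Qed.

End measurable_iter_draw.

Section mean_after.
Variables (A : 'M[int]_2) (keep : seq ('I_2 * nat) -> 'I_2 -> nat -> nat -> bitseq).
Variable R : realType.
Local Notation label := (nat * 'I_2 * nat)%type.
Variable Q : probability (clock_space R label) R.
Hypothesis Qiid : forall s V, uniq s -> (forall i, measurable (V i)) ->
  Q (cylinder s V) = (\prod_(i <- s) expo1 R (V i))%E.
Implicit Types (l : 'I_2 -> seq label) (h : seq ('I_2 * nat)) (F : urn R -> \bar R).
Local Open Scope ereal_scope.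

(** The mean of F after n draws from the labelled urn (s0, l, h) whose residual
    durations have law Q. *)
Definition mean_after F n (s0 : R) l h : \bar R :=
  \int[Q]_w F (iter n (draw A keep w) (labelled_urn s0 l h w)).

Definition coord (y : label) : {mfun clock_space R label >-> R} :=
  mk_mfun (measurable_coord y).

Definition cst_mfun (r : R) : {mfun clock_space R label >-> R} :=
  mk_mfun (@measurable_cst _ _ (clock_space R label) R setT r).

Lemma measurable_after F n s0 l h : urn_measurable F ->
  measurable_fun [set: clock_space R label]
    (fun w => F (iter n (draw A keep w) (labelled_urn s0 l h w))).
Proof.
move=> mF.
have := measurable_iter_draw A keep coord mF n (cst_mfun s0)
  (fun e => map (fun y => cst_mfun s0 + coord y)%R (l e)) h.
rewrite [X in measurable_fun _ X -> _](_ : _ = (fun w => F (iter n (draw A keep w)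
    (labelled_urn s0 l h w)))) => [//|].
apply/funext => w; congr (F (iter _ _ (Urn _ _ _))).
by apply/funext => e; rewrite /values -map_comp.
Qed.

Lemma measurable_forced F n s0 l h x : urn_measurable F ->
  measurable_fun [set: clock_space R label]
    (fun w => F (iter n (draw A keep w) (forced_draw A keep s0 l h x w))).
Proof.
move=> mF.
have := measurable_iter_draw A keep coord mF n (cst_mfun s0 + coord x)%R
  (fun e => map (fun y => if y \in all_labels l then cst_mfun s0 + coord y else
    cst_mfun s0 + coord x + coord y)%R (next_labels A keep l h x e)) (next_draws l h x).
rewrite [X in measurable_fun _ X -> _](_ : _ = (fun w => F (iter n (draw A keep w)
    (forced_draw A keep s0 l h x w)))) => [//|].
apply/funext => w; congr (F (iter _ _ (Urn _ _ _))).
by apply/funext => e; rewrite /values -map_comp; apply: eq_map => y /=; case: ifP.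
Qed.

(** First-step analysis: on the event that clock x is first, the draw is the
    forced one, [first_clock] replaces the clocks by residual durations at the
    epoch s0 + s, and the n remaining draws start from a labelled urn. *)
Lemma mean_afterS F n s0 l h : urn_measurable F -> (forall u, 0 <= F u) ->
  well_labelled l h -> (0 < size (all_labels l))%N ->
  mean_after F n.+1 s0 l h = \sum_(x <- all_labels l)
    \int[lebesgue_measure]_(s in `]0%R, +oo[)
      ((expR (- ((size (all_labels l))%:R * s)))%:E *
       mean_after F n (s0 + s)%R (next_labels A keep l h x) (next_draws l h x)).
Proof.
move=> mF F0 wf L0; have uL := uniq_all_labels wf.
rewrite /mean_after (integral_first_clock Qiid uL L0)//; last exact: measurable_after.
apply: eq_big_seq => x xL.
transitivity (\int[Q]_w ((is_first x (all_labels l) w)%:R%:E *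
    F (iter n (draw A keep w) (forced_draw A keep s0 l h x w)))).
  apply: eq_integral => w _; have [fx|_] := boolP (is_first _ _ _).
    by rewrite iterSr (draw_first _ _ _ wf xL fx).
  by rewrite !mul0e.
have ux : uniq (x :: rem x (all_labels l)).
  by rewrite /= mem_rem_uniq// inE eqxx rem_uniq.
rewrite (first_clock Qiid ux (measurable_forced n s0 l h x mF) (fun=> F0 _)).
rewrite (size_rem xL) (prednK L0); apply: eq_integral => s _; congr (_ * _).
apply: eq_integral => w _; rewrite (forced_draw_delay _ _ _ _ _ wf xL).
by rewrite (iter_draw_delay _ _ _ _ _ wf xL).
Qed.

End mean_after.

(** * The urns that occur: a k white and a k + D blue balls *)

Section shape.
Local Open Scope nat_scope.
Variables (a D : nat) (keep : seq ('I_2 * nat) -> 'I_2 -> nat -> nat -> bitseq).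
Hypotheses (a_gt0 : 0 < a) (D_gt0 : 0 < D) (keepP : removal_rule keep).
Local Notation A := (constant_differentials a).

(** Putting back the drawn ball keeps the count, so both colours change by the
    same amount; the removal rule enters by the number of balls it keeps. *)
Lemma size_replace_balls (X : Type) (x0 : X) h fresh c i l e : i < size (l c) ->
  (c == white -> a <= size (l e)) ->
  size (replace_balls A keep x0 h fresh c i l e) =
  if c == white then size (l e) - a else size (l e) + a.
Proof.
move=> il al; rewrite /replace_balls mxE /by_colour.
have sb : size (if e == c then set_nth x0 (l c) i (fresh c 0) else l e) = size (l e).
  case: eqVneq => [->|//]; rewrite size_set_nth; exact/maxn_idPr.
case: ifPn => cw; last by rewrite size_cat sb size_mkseq.
case: a a_gt0 (al cw) sb => // a' _ a'l /= sb.
have [sk ck] := keepP ((c, i) :: h) e a'l.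
rewrite sb size_mask ?sb ?sk//.
have := count_predC id (keep ((c, i) :: h) e (size (l e)) a'.+1).
rewrite (eq_count (a1 := predC id) (a2 := pred1 false)); last by case.
by rewrite ck sk => /(canRL (addnK _)).
Qed.

Definition has_shape (X : Type) (l : 'I_2 -> seq X) (k : nat) :=
  size (l white) = a * k /\ size (l blue) = a * k + D.

Definition next_shape (c : 'I_2) k := if c == white then k.-1 else k.+1.

Lemma shape_replace_balls (X : Type) (x0 : X) h fresh c i l k : i < size (l c) ->
  has_shape l k -> has_shape (replace_balls A keep x0 h fresh c i l) (next_shape c k).
Proof.
move=> il [lw lb]; rewrite /has_shape /next_shape.
have ak : c == white -> a <= a * k.
  move=> /eqP cw; move: il; rewrite cw lw; case: k {lw lb} => [|k _]; first by rewrite muln0.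
  by rewrite mulnS leq_addr.
have al e : c == white -> a <= size (l e).
  by move=> /ak akk; case: (colourP e) => ->; rewrite ?lw ?lb// (leq_trans akk)// leq_addr.
rewrite !size_replace_balls//; last 2 first.
- exact: al.
- exact: al.
case: ifPn => cw; rewrite lw lb.
  by rewrite -subn1 mulnBr muln1 addnBAC//; exact: ak.
by rewrite mulnS [a + _]addnC addnAC.
Qed.

Lemma shape_draw (R : realType) (E : nat * 'I_2 * nat -> R) (u : urn R) k :
  has_shape (rings u) k -> exists k', has_shape (rings (draw A keep E u)) k'.
Proof.
move=> su; rewrite drawE; case ci : (drawn_ball u) => [c i] /=.
exists (next_shape c k); apply: shape_replace_balls (su).
case: ci => <- <-; rewrite index_mem /drawn_colour; case: ifPn => // tw.
have : drawn_time u \in rings u white ++ rings u blue.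
  by apply: earliest_mem; rewrite size_cat su.2 !addn_gt0 D_gt0 !orbT.
by rewrite mem_cat (negbTE tw).
Qed.

Lemma shape_iter_draw (R : realType) (E : nat * 'I_2 * nat -> R) (u : urn R) k n :
  has_shape (rings u) k -> exists k', has_shape (rings (iter n (draw A keep E) u)) k'.
Proof.
by move=> su; elim: n => [|n [k' /shape_draw IHn]]; [exists k|exact: IHn].
Qed.

Local Notation label := (nat * 'I_2 * nat)%type.

Lemma shape_next (l : 'I_2 -> seq label) h k x : well_labelled l h -> x \in all_labels l ->
  has_shape l k -> has_shape (next_labels A keep l h x) (next_shape x.1.2 k).
Proof.
move=> wf xL sl; apply: shape_replace_balls => //.
by rewrite index_mem; exact: mem_all_labels wf xL.
Qed.

Lemma size_all_labels (l : 'I_2 -> seq label) k : has_shape l k ->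
  size (all_labels l) = 2 * a * k + D.
Proof. by move=> [lw lb]; rewrite size_cat lw lb addnA addnn -mul2n mulnA. Qed.

End shape.

(** * The first step and the absence of explosion *)

Section embedded_chain.
Variables (a D : nat) (keep : seq ('I_2 * nat) -> 'I_2 -> nat -> nat -> bitseq).
Hypotheses (a_gt0 : (0 < a)%N) (D_gt0 : (0 < D)%N) (keepP : removal_rule keep).
Local Notation A := (constant_differentials a).
Variable R : realType.
Local Notation label := (nat * 'I_2 * nat)%type.
Local Notation mu := (@lebesgue_measure R).
Variable Q : probability (clock_space R label) R.
Hypothesis Qiid : forall s V, uniq s -> (forall i, measurable (V i)) ->
  Q (cylinder s V) = (\prod_(i <- s) expo1 R (V i))%E.
Implicit Types (l : 'I_2 -> seq label) (h : seq ('I_2 * nat)) (F G : urn R -> \bar R).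
Local Open Scope ereal_scope.
Local Notation mean := (mean_after A keep Q).

Lemma measurable_mean_after F n s0 l h : urn_measurable F -> (forall u, 0 <= F u) ->
  measurable_fun [set: R] (fun s => mean F n (s0 + s)%R l h).
Proof.
move=> mF F0.
apply: (@measurable_fun_fubini_tonelli_F _ _ (measurableTypeR R) (clock_space R label) R Q
  (fun x => F (iter n (draw A keep x.2) (labelled_urn (s0 + x.1)%R l h x.2)))) => //.
pose T := (measurableTypeR R * clock_space R label)%type.
pose time : {mfun T >-> R} := mk_mfun (measurable_funD (measurable_cst s0)
  (@measurable_fst _ _ (measurableTypeR R) (clock_space R label) :
    measurable_fun setT (fst : T -> R))).
pose E (y : label) : {mfun T >-> R} := mk_mfun (measurableT_comp (@measurable_coord R _ y)
  (@measurable_snd _ _ (measurableTypeR R) (clock_space R label))).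
have := measurable_iter_draw A keep E mF n time
  (fun e => map (fun y => time + E y)%R (l e)) h.
rewrite [X in measurable_fun _ X -> _](_ : _ = (fun x : T => F (iter n (draw A keep x.2)
    (labelled_urn (s0 + x.1)%R l h x.2)))) => [//|].
apply/funext => w; congr (F (iter _ _ (Urn _ _ _))).
by apply/funext => e; rewrite /values -map_comp.
Qed.

Definition admissible l h k := well_labelled l h /\ has_shape a D l k.

Lemma admissible_next l h k x : admissible l h k -> x \in all_labels l ->
  admissible (next_labels A keep l h x) (next_draws l h x) (next_shape x.1.2 k).
Proof.
move=> [wf sl] xL; split; first exact: well_labelled_next.
exact: shape_next.
Qed.

Lemma admissible_gt0 l h k : admissible l h k -> (0 < size (all_labels l))%N.
Proof. by move=> [_ /size_all_labels ->]; rewrite addn_gt0 D_gt0 orbT. Qed.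

Lemma admissible_step F n s0 l h k : urn_measurable F -> (forall u, 0 <= F u) ->
  admissible l h k ->
  mean F n.+1 s0 l h = \sum_(x <- all_labels l)
    \int[mu]_(s in `]0%R, +oo[)
      ((expR (- ((size (all_labels l))%:R * s)))%:E *
       mean F n (s0 + s)%R (next_labels A keep l h x) (next_draws l h x)).
Proof. by move=> mF F0 adm; apply: mean_afterS => //; [exact: adm.1|exact: admissible_gt0 adm]. Qed.

Lemma mean_after_ge0 F n s0 l h : (forall u, 0 <= F u) -> 0 <= mean F n s0 l h.
Proof. by move=> F0; exact: integral_ge0. Qed.

Definition ball_count (k : nat) : R := (2 * a * k + D)%:R.

Definition discount (u : urn R) : \bar R := (expR (- ((2 * a)%:R * epoch u)))%:E.

Lemma urn_measurable_discount : urn_measurable discount.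
Proof.
move=> d T S l h /=; apply/measurable_EFinP; apply: measurableT_comp => //.
apply: measurableT_comp => //; apply: measurable_funM => //.
Qed.

(** If there are N balls, then the waiting time contributes
    E exp (- 2 a s) = N / (N + 2 a), and after the draw there are at most
    N + 2 a balls.  The product of n such factors telescopes to
    N / (N + 2 a n).  It tends to 0, so the epochs tend to infinity. *)
Lemma mean_discount_le n s0 l h k : admissible l h k ->
  mean discount n s0 l h <=
  (expR (- ((2 * a)%:R * s0)) * (ball_count k / (ball_count k + (2 * a * n)%:R)))%:E.
Proof.
elim: n s0 l h k => [|n IHn] s0 l h k adm.
  rewrite /mean_after /= /discount/= integral_probability_cst lee_fin.
  rewrite muln0 addr0 divff ?mulr1//.
  by rewrite pnatr_eq0 -lt0n addn_gt0 D_gt0 orbT.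
rewrite (admissible_step _ _ urn_measurable_discount _ adm)//; last first.
  by move=> u; rewrite lee_fin expR_ge0.
set N := size _.
have NE : N = (2 * a * k + D)%N by exact: size_all_labels adm.2.
(* C is the bound for n draws at k + 1; it covers the draw of a white ball as
   well, since the bound increases with the number of balls. *)
pose C : R := ((2 * a * k.+1 + D)%:R / ((2 * a * k.+1 + D)%:R + (2 * a * n)%:R))%R.
have C0 : (0 <= C)%R by rewrite /C divr_ge0.
have bound x : x \in all_labels l ->
   \int[mu]_(s in `]0%R, +oo[)
      ((expR (- (N%:R * s)))%:E *
       mean discount n (s0 + s)%R (next_labels A keep l h x) (next_draws l h x)) <=
   (expR (- ((2 * a)%:R * s0)) * C / (N + 2 * a)%:R)%:E.
  move=> xL.
  apply: (@le_trans _ _ (\int[mu]_(s in `]0%R, +oo[)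
     ((expR (- ((2 * a)%:R * s0)) * C)%:E * (expR (- ((N + 2 * a)%:R * s)))%:E))).
    apply: ge0_le_integral.
    - exact: measurable_itv.
    - move=> s _; rewrite mule_ge0 ?lee_fin ?expR_ge0// mean_after_ge0// => u.
      by rewrite lee_fin expR_ge0.
    - apply: emeasurable_funM; first exact: measurable_expR_scale.
      apply: measurable_funTS; apply: measurable_mean_after; first exact: urn_measurable_discount.
      by move=> u; rewrite lee_fin expR_ge0.
    - by apply: emeasurable_funM; [exact: measurable_cst|exact: measurable_expR_scale].
    - move=> s s0'; have := IHn (s0 + s)%R _ _ _ (admissible_next adm xL).
      move=> /(lee_wpmul2l _) H; apply: le_trans (H _ _) _; first by rewrite lee_fin expR_ge0.
      rewrite -!EFinM lee_fin mulrDr opprD expRD natrD mulrDl opprD expRD.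
      rewrite [leLHS](_ : _ = expR (- ((2 * a)%:R * s0)) * (ball_count (next_shape x.1.2 k) /
        (ball_count (next_shape x.1.2 k) + (2 * a * n)%:R)) *
        (expR (- (N%:R * s)) * expR (- ((2 * a)%:R * s))))%R; last by ring.
      rewrite ler_wpM2r ?mulr_ge0 ?expR_ge0// ler_wpM2l ?expR_ge0//.
      have kk : (next_shape x.1.2 k <= k.+1)%N.
        by rewrite /next_shape; case: ifP => // _; rewrite leqW// leq_pred.
      have b0 j : (0 < ball_count j)%R by rewrite ltr0n addn_gt0 D_gt0 orbT.
      rewrite /C -/(ball_count k.+1) ler_pdivrMr ?ltr_wpDr// mulrAC ler_pdivlMr ?ltr_wpDr//.
      rewrite !mulrDr (mulrC (ball_count k.+1) (ball_count (next_shape _ _))) lerD2l ler_wpM2r//.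
      by rewrite ler_nat leq_add2r leq_mul2l kk orbT.
  rewrite ge0_integralZl//; last 2 first.
  - exact: measurable_expR_scale.
  - by rewrite lee_fin mulr_ge0 ?expR_ge0.
  rewrite integral_expR_scale; last by rewrite ltr0n addn_gt0 muln_gt0 a_gt0 orbT.
  by rewrite -EFinM.
apply: (@le_trans _ _ (\sum_(x <- all_labels l)
    (expR (- ((2 * a)%:R * s0)) * C / (N + 2 * a)%:R)%:E)).
  by rewrite big_seq [leRHS]big_seq; exact: lee_sum.
rewrite sumEFin lee_fin big_const_seq count_predT iter_addr addr0 -/N.
have NCE : C = ((N + 2 * a)%:R / ((N + 2 * a)%:R + (2 * a * n)%:R))%R.
  by rewrite /C NE mulnS [(2 * a + _)%N]addnC addnAC.
have N0 : (0 < (N + 2 * a)%:R :> R)%R by rewrite ltr0n addn_gt0 muln_gt0 a_gt0 orbT.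
have -> : (ball_count k + (2 * a * n.+1)%:R = (N + 2 * a)%:R + (2 * a * n)%:R)%R.
  by rewrite /ball_count -NE -!natrD mulnS addnA.
rewrite NCE -[leLHS]mulr_natr /ball_count -NE le_eqVlt; apply/orP; left; apply/eqP.
set X := (N + 2 * a)%:R in N0 *; set m := (2 * a * n)%:R.
have m0 : (0 <= m)%R by rewrite /m ler0n.
move: X m N0 m0 => X m N0 m0.
by field; rewrite !gt_eqF// ltr_wpDr.
Qed.

End embedded_chain.

(** * A telescoping identity along the draws *)

Section dynkin.
Variables (a D : nat) (keep : seq ('I_2 * nat) -> 'I_2 -> nat -> nat -> bitseq).
Hypotheses (a_gt0 : (0 < a)%N) (D_gt0 : (0 < D)%N) (keepP : removal_rule keep).
Local Notation A := (constant_differentials a).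
Variable R : realType.
Local Notation label := (nat * 'I_2 * nat)%type.
Local Notation mu := (@lebesgue_measure R).
Variable Q : probability (clock_space R label) R.
Hypothesis Qiid : forall s V, uniq s -> (forall i, measurable (V i)) ->
  Q (cylinder s V) = (\prod_(i <- s) expo1 R (V i))%E.
Implicit Types (l : 'I_2 -> seq label) (h : seq ('I_2 * nat)) (F G : urn R -> \bar R).
Local Open Scope ereal_scope.
Local Notation mean := (mean_after A keep Q).
Local Notation admissible := (admissible a D).

Lemma mean_splitting F G : urn_measurable F -> urn_measurable G ->
  (forall u, 0 <= F u) -> (forall u, 0 <= G u) ->
  (forall s0 l h k, admissible l h k ->
    mean F 0 s0 l h = mean G 0 s0 l h + mean F 1 s0 l h) ->
  forall n s0 l h k, admissible l h k ->
    mean F n s0 l h = mean G n s0 l h + mean F n.+1 s0 l h.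
Proof.
move=> mF mG F0 G0 FG; elim=> [|n IHn] s0 l h k adm; first exact: FG adm.
rewrite (admissible_step _ D_gt0 Qiid n s0 mF F0 adm) (admissible_step _ D_gt0 Qiid n s0 mG G0 adm).
rewrite (admissible_step _ D_gt0 Qiid n.+1 s0 mF F0 adm) -big_split/=.
apply: eq_big_seq => x xL.
have mV (H : urn R -> \bar R) m : urn_measurable H -> (forall u, 0 <= H u) ->
    measurable_fun (`]0%R, +oo[%classic : set R)
      (fun s => (expR (- ((size (all_labels l))%:R * s)))%:E *
       mean H m (s0 + s)%R (next_labels A keep l h x) (next_draws l h x)).
  move=> mH H0; apply: emeasurable_funM; first exact: measurable_expR_scale.
  by apply: measurable_funTS; apply: measurable_mean_after.
have V0 (H : urn R -> \bar R) m s : (forall u, 0 <= H u) ->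
    0 <= (expR (- ((size (all_labels l))%:R * s)))%:E *
       mean H m (s0 + s)%R (next_labels A keep l h x) (next_draws l h x).
  by move=> H0; rewrite mule_ge0 ?lee_fin ?expR_ge0// mean_after_ge0.
rewrite -ge0_integralD; last 5 first.
- exact: measurable_itv.
- by move=> s _; exact: V0.
- exact: mV.
- by move=> s _; exact: V0.
- exact: mV.
apply: eq_integral => s _.
rewrite -ge0_muleDr ?mean_after_ge0//; congr (_ * _).
exact: IHn (admissible_next a_gt0 keepP adm xL).
Qed.

(** If the mean of F after one draw falls short of its present value by the
    present mean of G, then by first-step analysis this remains so after any
    number of draws ([mean_splitting]), and the losses add up. *)
Lemma mean_telescope F G : urn_measurable F -> urn_measurable G ->
  (forall u, 0 <= F u) -> (forall u, 0 <= G u) ->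
  (forall s0 l h k, admissible l h k ->
    mean F 0 s0 l h = mean G 0 s0 l h + mean F 1 s0 l h) ->
  forall n s0 l h k, admissible l h k ->
    mean F 0 s0 l h = \sum_(0 <= i < n) mean G i s0 l h + mean F n s0 l h.
Proof.
move=> mF mG F0 G0 FG n s0 l h k adm; elim: n => [|n IHn].
  by rewrite big_geq// add0e.
rewrite IHn big_nat_recr//= -addeA; congr (_ + _).
exact: mean_splitting adm.
Qed.

Lemma expo1_tail (u : R) : (0 <= u)%R -> expo1 R `]u, +oo[%classic = (expR (- u))%:E.
Proof.
move=> u0; have := expo1_memoryless u0 (@measurable_cst _ _ _ _ setT (1 : \bar R)) (fun=> lee01).
rewrite integral_probability_cst mule1 => <-.
transitivity (\int[expo1 R]_x (\1_(`]u, +oo[%classic : set R) x)%:E).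
  by rewrite integral_indic// setIT.
apply: eq_integral => x _.
by rewrite mule1 indicE mem_setE in_itv/= andbT.
Qed.

Definition pairs (u : urn R) : nat := (size (rings u white) %/ a)%N.

(** A potential and its running gain.  If g solves the backward equation for phi,
    then [before t g] decreases at each draw, in mean, by [during t phi], which
    picks out the state at time t. *)
Definition before (t : R) (g : R -> nat -> R) (u : urn R) : \bar R :=
  ((epoch u <= t)%R%:R * g (t - epoch u)%R (pairs u))%:E.

Definition during (t : R) (phi : nat -> R) (u : urn R) : \bar R :=
  ((epoch u <= t < drawn_time u)%R%:R * phi (pairs u))%:E.

Lemma urn_measurable_before t g : (forall k, measurable_fun setT (g ^~ k)) ->
  urn_measurable (before t g).
Proof.
move=> mg d T S l h; rewrite /before/= /pairs/= /values; under eq_fun do rewrite size_map EFinM.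
apply: emeasurable_funM.
  by apply: measurable_bool_indic; apply: measurable_fun_ler => //.
apply/measurable_EFinP; apply: (measurableT_comp (mg _)).
by apply: measurable_funB.
Qed.

Lemma urn_measurable_during t phi : urn_measurable (during t phi).
Proof.
move=> d T S l h; rewrite /during/= /pairs/= {1}/values; under eq_fun do rewrite size_map EFinM.
apply: emeasurable_funM => //.
apply: measurable_bool_indic; apply: measurable_and; first exact: measurable_fun_ler.
apply: measurable_fun_ltr => //.
rewrite /drawn_time/=.
have := measurable_earliest (l white ++ l blue).
by rewrite /values; under eq_fun do rewrite map_cat.
Qed.

Lemma pairs_labelled s0 l h k w : admissible l h k -> pairs (labelled_urn s0 l h w) = k.
Proof. by move=> [_ [lw _]]; rewrite /pairs/= size_map lw mulKn. Qed.

Lemma mean0_before t g s0 l h k : admissible l h k ->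
  mean (before t g) 0 s0 l h = ((s0 <= t)%R%:R * g (t - s0)%R k)%:E.
Proof.
move=> adm; rewrite /mean_after /= /before /=.
by under eq_integral do rewrite (pairs_labelled _ _ adm); rewrite integral_probability_cst.
Qed.

(** No clock rings up to t: the number of running clocks is
    [ball_count], and each survives with probability exp (- (t - s0)). *)
Lemma mean0_during t phi s0 l h k : (forall k, 0 <= phi k)%R -> admissible l h k ->
  mean (during t phi) 0 s0 l h =
  ((s0 <= t)%R%:R * (phi k * expR (- (ball_count a D R k * (t - s0)))))%:E.
Proof.
move=> phi0 adm; have [wf sl] := adm; rewrite /mean_after /= /during /=.
under eq_integral do rewrite (pairs_labelled _ _ adm).
have [st|st] := boolP (s0 <= t)%R; last first.
  transitivity (0 : \bar R); last by rewrite mul0r.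
  by apply: integral0_eq => w _; rewrite mul0r.
set u := (t - s0)%R; have u0 : (0 <= u)%R by rewrite subr_ge0.
pose C := cylinder (all_labels l) (fun=> `]u, +oo[%classic) : set (clock_space R label).
have mC : measurable C by apply: measurable_cylinder => i.
transitivity (\int[Q]_w ((phi k)%:E * (\1_C w)%:E)).
  apply: eq_integral => w _; rewrite /= mulrC EFinM; congr (_ * _%:E).
  rewrite /drawn_time lt_earliest; last first.
    by rewrite -map_cat size_map (admissible_gt0 D_gt0 adm).
  rewrite indicE -map_cat all_map; congr (nat_of_bool _)%:R.
  apply/allP/idP => [H|/set_mem H y yL].
    by apply/mem_set => y /H; rewrite /= in_itv/= andbT ltrBlDl.
  by have := H y yL; rewrite /= in_itv/= andbT ltrBlDl.
rewrite ge0_integralZl ?lee_fin//; last exact/measurable_EFinP/measurable_indic.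
rewrite integral_indic// setIT.
transitivity ((phi k)%:E * (expR (- u) ^+ (2 * a * k + D))%:E).
  congr (_ * _); transitivity (\prod_(i <- all_labels l) expo1 R `]u, +oo[%classic).
    by apply: Qiid => //; exact: uniq_all_labels wf.
  rewrite big_const_seq count_predT (size_all_labels sl).
  elim: (2 * a * k + D)%N => [|n IHn]; first by rewrite expr0.
  by rewrite iterS IHn expo1_tail// -EFinM exprS.
by rewrite -EFinM mul1r -expRM_natl mulrN.
Qed.

(** The summand of a label depends on its colour only; there are a k white balls,
    which lead to k - 1, and a k + D blue ones, which lead to k + 1. *)
Lemma mean1_before (t : R) (g : R -> nat -> R) s0 l h k :
  (forall k, measurable_fun setT (g ^~ k)) ->
  (forall u k, 0 <= u -> 0 <= g u k)%R -> admissible l h k -> (s0 <= t)%R ->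
  mean (before t g) 1 s0 l h =
  (a * k)%:R%:E * \int[mu]_(s in `]0%R, +oo[)
    (expR (- (ball_count a D R k * s)) * ((s <= t - s0)%R%:R * g (t - s0 - s) k.-1))%:E +
  (a * k + D)%:R%:E * \int[mu]_(s in `]0%R, +oo[)
    (expR (- (ball_count a D R k * s)) * ((s <= t - s0)%R%:R * g (t - s0 - s) k.+1))%:E.
Proof.
move=> mg g0 adm st; have [wf sl] := adm.
have b0 u : 0 <= before t g u.
  rewrite /before lee_fin; case: (boolP (epoch u <= t)%R) => h0; last by rewrite mul0r.
  by rewrite mul1r g0// subr_ge0.
rewrite (admissible_step _ D_gt0 Qiid 0 s0 (urn_measurable_before t mg) b0 adm).
pose I j := \int[mu]_(s in `]0%R, +oo[)
    (expR (- (ball_count a D R k * s)) * ((s <= t - s0)%R%:R * g (t - s0 - s) j))%:E.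
rewrite (eq_big_seq (fun x : label => I (next_shape x.1.2 k))); last first.
  move=> x xL; apply: eq_integral => s _.
  rewrite (mean0_before _ _ _ (admissible_next a_gt0 keepP adm xL)) -EFinM.
  by rewrite (size_all_labels sl) lerBrDl opprD addrA.
have sum_e e : \sum_(x <- l e) I (next_shape x.1.2 k) = (size (l e))%:R%:E * I (next_shape e k).
  rewrite (eq_big_seq (fun=> I (next_shape e k))); last first.
    by move=> x xl; have [_ /(_ _ xl)[_ ->]] := wf e.
  rewrite big_const_seq count_predT.
  elim: (size (l e)) => [|n IHn]; first by rewrite mul0e.
  rewrite iterS IHn -natr1 EFinD ge0_muleDl ?lee_fin// mul1e addeC//.
by rewrite big_cat/= !sum_e sl.1 sl.2.
Qed.

End dynkin.

(** * The law of the process at a fixed time *)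

Section process.
Variables (a D k0 : nat) (keep : seq ('I_2 * nat) -> 'I_2 -> nat -> nat -> bitseq).
Hypotheses (a_gt0 : (0 < a)%N) (D_gt0 : (0 < D)%N) (keepP : removal_rule keep).
Local Notation A := (constant_differentials a).
Local Notation x0 := (by_colour (a * k0)%N (a * k0 + D)%N).
Local Notation label := (nat * 'I_2 * nat)%type.
Context d (T : measurableType d) (R : realType) (P : probability T R).
Local Notation mu := (@lebesgue_measure R).
Variable clock : label -> {RV P >-> R}.
Hypothesis clock_indep : mutually_independent clock.
Hypothesis clock_exp : forall i V, measurable V ->
  distribution P (clock i) V = exponential_prob 1 V.
Local Open Scope ereal_scope.

Definition clocks (w : T) : clock_space R label := fun i => clock i w.

Lemma measurable_clocks : measurable_fun setT clocks.
Proof. by apply: measurable_fun_coord => i; exact: measurable_funPT. Qed.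

Definition clocks_mfun : {mfun T >-> clock_space R label} :=
  HB.pack clocks (isMeasurableFun.Build _ _ _ _ _ measurable_clocks).

Local Notation Q := (distribution P clocks_mfun).

Lemma clocks_iid s V : uniq s -> (forall i, measurable (V i)) ->
  Q (cylinder s V) = \prod_(i <- s) expo1 R (V i).
Proof.
move=> us mV; transitivity (P (\bigcap_(i in [set` s]) (clock i @^-1` V i))).
  congr (P _); apply/seteqP; split => w h i /= si; exact: h.
rewrite clock_indep//; apply: eq_bigr => i _.
exact: clock_exp.
Qed.

Definition urn_at (w : T) (n : nat) : urn R :=
  urn_after A x0 keep (fun i => clock i w) n.

Definition initial_labels (e : 'I_2) : seq label := mkseq (fun k => (0%N, e, k)) (x0 e).

Lemma initial_admissible : admissible a D initial_labels [::] k0.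
Proof.
split; last by split; rewrite /initial_labels size_mkseq.
move=> e; split; first by rewrite map_inj_uniq ?iota_uniq// => i j [].
by move=> y /mapP[j _ ->].
Qed.

Lemma urn_atE w n : urn_at w n = iter n (draw A keep (clocks w))
  (labelled_urn 0%R initial_labels [::] (clocks w)).
Proof.
congr iter; rewrite /init_urn /labelled_urn; congr Urn; apply/funext => e.
by rewrite /initial_labels /mkseq -map_comp; apply: eq_map => i /=; rewrite add0r.
Qed.

Lemma mean_urn_at F n : urn_measurable F -> (forall u, 0 <= F u) ->
  \int[P]_w F (urn_at w n) = mean_after A keep Q F n 0 initial_labels [::].
Proof.
move=> mF F0; rewrite /mean_after ge0_integral_distribution//; last first.
  exact: measurable_after.
by apply: eq_integral => w _; rewrite urn_atE.
Qed.

Lemma measurable_urn_at F n : urn_measurable F -> measurable_fun setT (fun w => F (urn_at w n)).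
Proof.
move=> mF; have := measurableT_comp
  (measurable_after A keep n 0 initial_labels [::] mF) measurable_clocks.
by apply: eq_measurable_fun => w _ /=; rewrite urn_atE.
Qed.

Lemma epoch_cover w t M : (0 <= t)%R ->
  (exists2 n, (n < M)%N & (epoch (urn_at w n) <= t < epoch (urn_at w n.+1))%R) \/
  (epoch (urn_at w M) <= t)%R.
Proof.
move=> t0; elim: M => [|M [[n nM h]|h]]; first by right.
  by left; exists n => //; exact: ltnW.
by case: (leP (epoch (urn_at w M.+1)) t) => h'; [right|left; exists M; rewrite ?h].
Qed.

(** The indicator of epoch <= t is at most exp (2 a (t - epoch)), whose mean
    tends to 0 by [mean_discount_le]. *)
Lemma explosion_null t (e : R) : (0 <= t)%R -> (0 < e)%R -> exists M,
  \int[P]_w (before a t (fun _ _ => 1%R) (urn_at w M)) <= e%:E.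
Proof.
move=> t0 e0.
pose N := ball_count a D R k0; pose c := expR ((2 * a)%:R * t).
(* The bound c N / (N + 2 a M) has to be at most e. *)
exists (Num.trunc (c * N / e)).+1; set M := _.+1.
have mb : urn_measurable (before a t (fun _ _ => 1%R) : urn R -> \bar R).
  exact: urn_measurable_before.
rewrite mean_urn_at//; last by move=> u; rewrite lee_fin mulr1.
apply: (@le_trans _ _ (c%:E * mean_after A keep Q (@discount a R) M 0 initial_labels [::])).
  rewrite /mean_after -ge0_integralZl//; last 3 first.
  - by apply: measurable_after; exact: urn_measurable_discount.
  - by move=> u _; rewrite lee_fin expR_ge0.
  - by rewrite lee_fin expR_ge0.
  apply: ge0_le_integral => //.
  - by move=> w _; rewrite lee_fin mulr1.
  - exact: measurable_after.
  - apply: emeasurable_funM => //; apply: measurable_after.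
    exact: urn_measurable_discount.
  - move=> w _; rewrite /before /discount -EFinM lee_fin mulr1 -expRD.
    case: (boolP (_ <= t)%R) => h; last by rewrite expR_ge0.
    rewrite -[leLHS]expR0 ler_expR -mulrN -mulrDr mulr_ge0// subr_ge0//.
have := mean_discount_le a_gt0 D_gt0 keepP clocks_iid M 0 initial_admissible.
move=> /(lee_wpmul2l _) H; apply: le_trans (H _ _) _; first by rewrite lee_fin expR_ge0.
rewrite -EFinM lee_fin mulr0 oppr0 expR0 mul1r.
have N0 : (0 < N)%R by rewrite ltr0n addn_gt0 D_gt0 orbT.
have D0 : (0 < N + (2 * a * M)%:R)%R by rewrite ltr_wpDr.
rewrite -/N mulrA ler_pdivrMr// -ler_pdivrMl// mulrC.
have : (c * N / e < M%:R)%R by exact: truncnS_gt.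
move=> /ltW /le_trans; apply; apply: (@le_trans _ _ (2 * a * M)%:R%R).
  by rewrite ler_nat leq_pmull// muln_gt0.
by rewrite lerDr ltW.
Qed.

(** Decomposition at the first jump of the chain: the rates a k and a k + D of
    the two jumps add up to the number of balls. *)
Definition backward_equation (phi : nat -> R) (g : R -> nat -> R) := forall u k, (0 <= u)%R ->
  (g u k)%:E = (phi k * expR (- (ball_count a D R k * u)))%:E +
    ((a * k)%:R%:E * \int[mu]_(s in `]0%R, +oo[)
      (expR (- (ball_count a D R k * s)) * ((s <= u)%R%:R * g (u - s) k.-1))%:E +
    (a * k + D)%:R%:E * \int[mu]_(s in `]0%R, +oo[)
      (expR (- (ball_count a D R k * s)) * ((s <= u)%R%:R * g (u - s) k.+1))%:E).

(** By the backward equation, F = [before] loses G = [during] in mean at each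
    draw, so g(t, k0) is at least the sum of the means of the first M gains.
    These gains dominate X except when the M-th epoch is at most t, an event of
    small probability.  *)
Lemma expectation_le_backward (t : R) (phi : nat -> R) (g : R -> nat -> R) (X : T -> R) :
  (0 <= t)%R -> (forall k, 0 <= phi k)%R ->
  (forall k, measurable_fun setT (g ^~ k)) ->
  (forall u k, 0 <= u -> 0 <= g u k)%R ->
  backward_equation phi g ->
  measurable_fun setT X -> (forall w, 0 <= X w <= 1)%R ->
  {ae P, forall w, forall n, (epoch (urn_at w n) <= t < epoch (urn_at w n.+1))%R ->
    X w = phi (pairs a (urn_at w n))} ->
  \int[P]_w (X w)%:E <= (g t k0)%:E.
Proof.
move=> t0 phi0 mg g0 backward mX X01 XE.
have mbg : urn_measurable (before a t g) by exact: urn_measurable_before.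
have md : urn_measurable (during a t phi) by exact: urn_measurable_during.
have bg0 u : 0 <= before a t g u.
  rewrite /before lee_fin; case: (boolP (epoch u <= t)%R) => h0; last by rewrite mul0r.
  by rewrite mul1r g0// subr_ge0.
have d0 u : 0 <= during a t phi u by rewrite lee_fin mulr_ge0.
have base s0 l h k : admissible a D l h k ->
    mean_after A keep Q (before a t g) 0 s0 l h =
    mean_after A keep Q (during a t phi) 0 s0 l h + mean_after A keep Q (before a t g) 1 s0 l h.
  move=> adm; rewrite (mean0_before _ a_gt0 _ _ _ _ adm)
    (mean0_during _ a_gt0 D_gt0 clocks_iid _ _ phi0 adm).
  have [st|st] := leP s0 t.
    rewrite (mean1_before a_gt0 D_gt0 keepP clocks_iid mg g0 adm st) !mul1r.
    by rewrite -backward// subr_ge0.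
  rewrite (admissible_step _ D_gt0 clocks_iid 0 s0 mbg bg0 adm) !mul0r add0e.
  rewrite big_seq big1// => x xL; apply: integral0_eq => s; rewrite /= in_itv/= andbT => s_gt0.
  rewrite (mean0_before _ a_gt0 _ _ _ _ (admissible_next a_gt0 keepP adm xL)).
  by rewrite leNgt (lt_trans st) ?ltrDl// mul0r mule0.
apply/lee_addgt0Pr => e e0; have [M eM] := explosion_null t0 e0.
have mb1 : urn_measurable (before a t (fun _ _ => 1%R) : urn R -> \bar R).
  exact: urn_measurable_before.
have b10 (u : urn R) : 0 <= before a t (fun _ _ => 1%R) u by rewrite lee_fin mulr1.
have ms : measurable_fun setT (fun w => \sum_(0 <= n < M) during a t phi (urn_at w n)).
  by apply: emeasurable_sum => n; exact: measurable_urn_at.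
have s0 w : 0 <= \sum_(0 <= n < M) during a t phi (urn_at w n) by exact: sume_ge0.
apply: (@le_trans _ _ (\int[P]_w (\sum_(0 <= n < M) during a t phi (urn_at w n) +
    before a t (fun _ _ => 1%R) (urn_at w M)))).
  apply: ae_ge0_le_integral => //.
  - by move=> w _; rewrite lee_fin; case/andP: (X01 w).
  - exact/measurable_EFinP.
  - by move=> w _; rewrite adde_ge0.
  - by apply: emeasurable_funD => //; exact: measurable_urn_at.
  - apply: filterS XE => w XE _.
    have [[n nM h]|h] := epoch_cover w M t0.
      rewrite (XE _ h) (bigD1_seq n) ?mem_index_iota ?iota_uniq//=.
      rewrite -addeA -[leLHS]adde0 leeD//.
        rewrite /during lee_fin; move: h; rewrite {2}/urn_at/= => -> .
        by rewrite mul1r.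
      by rewrite adde_ge0// sume_ge0.
    rewrite -[leLHS]add0e leeD// /before h mul1r lee_fin.
    by case/andP: (X01 w).
rewrite ge0_integralD//; last exact: measurable_urn_at.
rewrite leeD//.
rewrite ge0_integral_sum//; last by move=> n; exact: measurable_urn_at.
have := mean_telescope a_gt0 D_gt0 keepP clocks_iid mbg md bg0 d0 base M 0 initial_admissible.
rewrite (mean0_before _ a_gt0 _ _ _ _ initial_admissible) t0 mul1r subr0 => ->.
under eq_bigr do rewrite mean_urn_at//.
by rewrite leeDl// mean_after_ge0.
Qed.

End process.

(** * A solution of the backward Kolmogorov equation *)

Section birth_death.
Variables (a D : nat) (R : realType).
Hypothesis a_gt0 : (0 < a)%N.
Implicit Types (u s z : R) (k : nat).

(** The backward equation of the chain; for k = 0 the value k.-1 = 0 is harmless,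
    the rate a k of the downward jump being 0. *)
Definition kolmogorov (g : R -> nat -> R) := forall u k, 0 <= u ->
  is_derive u 1 (g ^~ k) ((a * k)%:R * (g u k.-1 - g u k) +
                          (a * k + D)%:R * (g u k.+1 - g u k)).

Variable sg : R.
Hypothesis sg0 : 0 <= sg.

(** With s(u) = 1 + a sigma u, [pgf] is s^(- D / a) (1 - sigma / s)^k.  For D = 0
    this is the generating function of a critical linear birth and death chain,
    and the first factor accounts for the immigration.  Exponentials of ln s
    make all powers differentiable by the chain rule. *)
Definition log_scale u := ln (1 + a%:R * sg * u).
Definition inv_scale u := expR (- log_scale u).
Definition pgf u k := expR (- (D%:R / a%:R) * log_scale u) * (1 - sg * inv_scale u) ^+ k.

Lemma scale_gt0 u : 0 <= u -> 0 < 1 + a%:R * sg * u.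
Proof. by move=> u0; rewrite ltr_pwDl// !mulr_ge0. Qed.

Lemma inv_scaleE u : 0 <= u -> inv_scale u = (1 + a%:R * sg * u)^-1.
Proof. by move=> u0; rewrite /inv_scale expRN lnK// posrE scale_gt0. Qed.

Lemma is_derive_log_scale u : 0 <= u ->
  is_derive u 1 log_scale (a%:R * sg * inv_scale u).
Proof.
move=> u0; have p := scale_gt0 u0; rewrite inv_scaleE//.
have h1 : is_derive u 1 (fun x => 1 + a%:R * sg * x) (a%:R * sg).
  have h : is_derive u 1 (cst 1 + (a%:R * sg) *: (id : R -> R)) (0 + (a%:R * sg) *: 1).
    exact: is_deriveD.
  by apply: (is_derive_eq h); rewrite add0r [_ *: _]mulr1.
have := @is_derive1_comp R (@ln R) (fun x => 1 + a%:R * sg * x) u _ _ (is_derive1_ln p) h1.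
by rewrite [_^-1 * _]mulrC.
Qed.

Lemma is_derive_expR_comp (f : R -> R) u df : is_derive u 1 f df ->
  is_derive u 1 (fun x => expR (f x)) (expR (f u) * df).
Proof. by move=> h; exact: is_derive1_comp. Qed.

Lemma kolmogorov_pgf : kolmogorov pgf.
Proof.
move=> u k u0.
have dl := is_derive_log_scale u0.
set q := inv_scale u in dl *.
have dq : is_derive u 1 inv_scale (- (a%:R * sg * q ^+ 2)).
  have := is_derive_expR_comp (is_deriveN dl).
  by rewrite mulrN -/(inv_scale u) -/q mulrCA expr2 => h; apply: is_derive_eq h _; ring.
have dE : is_derive u 1 (fun x => expR (- (D%:R / a%:R) * log_scale x))
    (- (D%:R * sg * q) * expR (- (D%:R / a%:R) * log_scale u)).
  have := is_derive_expR_comp (is_deriveZ (- (D%:R / a%:R)) dl).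
  move=> h; apply: is_derive_eq h _; rewrite /GRing.scale/=.
  field; by rewrite pnatr_eq0 -lt0n.
have df : is_derive u 1 (fun x => 1 - sg * inv_scale x) (a%:R * sg ^+ 2 * q ^+ 2).
  have : is_derive u 1 (cst 1 - sg *: inv_scale) (0 - sg *: (- (a%:R * sg * q ^+ 2))).
    exact: is_deriveB.
  move=> h; apply: is_derive_eq h _; rewrite /GRing.scale/=; ring.
have dfk : is_derive u 1 (fun x => (1 - sg * inv_scale x) ^+ k)
    (k%:R * (1 - sg * q) ^+ k.-1 * (a%:R * sg ^+ 2 * q ^+ 2)).
  by have := is_deriveX k df; rewrite exprfctE.
have := is_deriveM dE dfk => h; apply: is_derive_eq h _.
rewrite /GRing.scale/= /pgf -/q; set E := expR _.
case: k {dfk} => [|k] /=; rewrite ?muln0 ?mul0r ?mulr0 ?add0r ?expr0 ?exprS; ring.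
Qed.

Lemma pgf0 k : pgf 0 k = (1 - sg) ^+ k.
Proof.
by rewrite /pgf /inv_scale /log_scale mulr0 addr0 ln1 mulr0 oppr0 expR0 mul1r mulr1.
Qed.

Lemma pgf_bounds u k : sg <= 1 -> 0 <= u -> 0 <= pgf u k <= 1.
Proof.
move=> sg1 u0.
have l0 : 0 <= log_scale u by rewrite ln_ge0// lerDl !mulr_ge0.
have q1 : inv_scale u <= 1 by rewrite -expR0 ler_expR oppr_le0.
have q0 : 0 <= inv_scale u by exact: expR_ge0.
have f0 : 0 <= 1 - sg * inv_scale u by rewrite subr_ge0 mulr_ile1.
have f1 : 1 - sg * inv_scale u <= 1 by rewrite gerBl mulr_ge0.
rewrite mulr_ge0 ?expR_ge0 ?exprn_ge0//= mulr_ile1 ?expR_ge0 ?exprn_ge0 ?exprn_ile1//.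
by rewrite -expR0 ler_expR mulNr oppr_le0 mulr_ge0// divr_ge0.
Qed.

Lemma measurable_pgf k : measurable_fun setT (pgf ^~ k).
Proof.
have ml : measurable_fun setT log_scale.
  apply: measurableT_comp; first exact: measurable_ln.
  by apply: measurable_funD => //; exact: measurable_funM.
apply: measurable_funM.
  by apply: measurableT_comp => //; exact: measurable_funM.
apply: measurable_funX; apply: measurable_funB => //; apply: measurable_funM => //.
by apply: measurableT_comp => //; exact: measurableT_comp.
Qed.

End birth_death.

(** * From the differential to the integral equation *)

Section backward.
Variables (a D : nat) (R : realType) (g : R -> nat -> R) (phi : nat -> R).
Hypotheses (gK : kolmogorov a D g) (g_init : forall k, g 0 k = phi k).
Hypothesis mg : forall k, measurable_fun setT (g ^~ k).
Hypothesis g_ge0 : forall u k, 0 <= u -> 0 <= g u k.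
Local Notation mu := (@lebesgue_measure R).

(** The integrand of the backward equation on [0, u]: the state j and the
    remaining time u - s, damped by the probability that no clock rings in state
    k up to s. *)
Definition damped (u : R) (k j : nat) (s : R) := expR (- (ball_count a D R k * s)) * g (u - s) j.

Lemma damped_integral (u : R) k j : 0 <= u ->
  (\int[mu]_(s in `]0%R, +oo[)
      (expR (- (ball_count a D R k * s)) * ((s <= u)%R%:R * g (u - s) j))%:E =
   \int[mu]_(s in `[0%R, u]) (damped u k j s)%:E)%E.
Proof.
move=> u0.
have md : measurable_fun [set: R] (fun s => (expR (- (ball_count a D R k * s)) *
    ((s <= u)%R%:R * g (u - s) j))%:E).
  apply/measurable_EFinP; apply: measurable_funM.
    by apply/measurable_EFinP; exact: measurable_expR_scale.
  apply: measurable_funM.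
    by apply/measurable_EFinP; apply: measurable_bool_indic; exact: measurable_fun_ler.
  by apply: (measurableT_comp (mg j)); exact: measurable_funB.
rewrite integral_itv_obnd_cbnd; last exact: measurable_funTS.
rewrite integral_mkcond [RHS]integral_mkcond; apply: eq_integral => s _.
rewrite !patchE !mem_setE !in_itv/= andbT.
by case: (0 <= s); case: (s <= u); rewrite ?mul1r ?mul0r ?mulr0.
Qed.

Lemma is_derive_damped (u : R) k j (s : R) : s <= u ->
  is_derive s 1 (damped u k j) (- (expR (- (ball_count a D R k * s)) *
   (ball_count a D R k * g (u - s) j + ((a * j)%:R * (g (u - s) j.-1 - g (u - s) j) +
                          (a * j + D)%:R * (g (u - s) j.+1 - g (u - s) j))))).
Proof.
rewrite -subr_ge0 => su.
have d1 : is_derive s 1 (fun s => u - s) (- 1).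
  rewrite (_ : (fun x => _) = cst u - (id : R -> R))//.
  by apply: is_derive_eq; rewrite add0r.
have dg := @is_derive1_comp R (g ^~ j) (fun s => u - s) s _ _ (gK j su) d1.
have dN : is_derive s 1 (fun s => - (ball_count a D R k * s)) (- ball_count a D R k).
  rewrite (_ : (fun x => _) = - (ball_count a D R k *: (id : R -> R)))//.
  by apply: is_derive_eq; rewrite [_ *: _]mulr1.
have := is_deriveM (is_derive_expR_comp dN) dg => h; apply: is_derive_eq h _.
by rewrite /GRing.scale/=; ring.
Qed.

(** In the derivative of the damped function with j = k, the terms in g(u - s, k)
    cancel, because the number of balls is the sum of the two rates.  What is
    left is minus the integrand of the two jump terms, and integrating it from 0
    to u is the claim. *)
Lemma backward_of_kolmogorov : backward_equation a D phi g.
Proof.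
move=> u k u0; rewrite !damped_integral//.
have [<-|u_neq0] := eqVneq 0 u.
  by rewrite set_itv1 !integral_set1 !mule0 !adde0 g_init mulr0 oppr0 expR0 mulr1.
have {u_neq0} u_gt0 : 0 < u by rewrite lt_def eq_sym u_neq0.
have cd j s : s <= u -> {for s, continuous (damped u k j)}.
  move=> su; have [d _] := is_derive_damped k j su.
  exact/differentiable_continuous/derivable1_diffP.
have cdw j : {within `[0, u], continuous (damped u k j)}.
  apply: continuous_in_subspaceT => s; rewrite inE/= in_itv/= => /andP[_ su].
  exact: cd.
pose H s := (a * k)%:R * damped u k k.-1 s + (a * k + D)%:R * damped u k k.+1 s.
(* The boundary terms are phi k, damped, at s = u and g u k at s = 0. *)
have FTC : (\int[mu]_(s in `[0%R, u]) (H s)%:E =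
    (- damped u k k u)%:E - (- damped u k k 0)%:E)%E.
  apply: (@continuous_FTC2 R H (fun s => - damped u k k s)) => //.
  - apply: continuous_in_subspaceT => s; rewrite inE/= in_itv/= => /andP[_ su].
    by apply: cvgD; apply: cvgM; [exact: cvg_cst|exact: cd|exact: cvg_cst|exact: cd].
  - split.
    + move=> s; rewrite in_itv/= => /andP[_ /ltW su].
      by apply: derivableN; have [] := is_derive_damped k k su.
    + by apply: cvgN; apply: cvg_at_right_filter; exact: cd.
    + by apply: cvgN; apply: cvg_at_left_filter; exact: cd.
  - move=> s; rewrite in_itv/= => /andP[_ /ltW su].
    have := is_deriveN (is_derive_damped k k su) => -[_].
    rewrite derive1E => ->; rewrite opprK /H /damped /ball_count.
    rewrite (_ : (2 * a * k + D)%:R = (a * k)%:R + (a * k + D)%:R :> R); last first.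
      by rewrite -natrD addnA addnn -mul2n mulnA.
    by ring.
have mdj j : measurable_fun `[0, u] (fun s => (damped u k j s)%:E).
  by apply/measurable_EFinP; apply: subspace_continuous_measurable_fun => //; exact: cdw.
have dj0 j s : `[0, u]%classic s -> (0 <= (damped u k j s)%:E)%E.
  rewrite /= in_itv/= => /andP[_ su].
  by rewrite lee_fin mulr_ge0 ?expR_ge0// g_ge0// subr_ge0.
have Zl (c : nat) j : (c%:R%:E * \int[mu]_(s in `[0%R, u]) (damped u k j s)%:E =
    \int[mu]_(s in `[0%R, u]) (c%:R%:E * (damped u k j s)%:E))%E.
  by rewrite ge0_integralZl// ?lee_fin//; [exact: mdj|exact: dj0].
rewrite !Zl.
rewrite -ge0_integralD//; last 4 first.
- by move=> s su; apply: mule_ge0; [rewrite lee_fin|exact: dj0 su].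
- by apply: emeasurable_funM => //; exact: mdj.
- by move=> s su; apply: mule_ge0; [rewrite lee_fin|exact: dj0 su].
- by apply: emeasurable_funM => //; exact: mdj.
rewrite [X in (_ + X)%E](_ : _ = (\int[mu]_(s in `[0%R, u]) (H s)%:E)%E)//.
rewrite FTC -!EFinN -!EFinD /damped subrr subr0 g_init mulr0 oppr0 expR0 mul1r opprK.
by congr EFin; ring.
Qed.

End backward.

(** * The generating function of the number of pairs *)

(** The generator of the chain annihilates constants. *)
Lemma kolmogorov_affine (a D : nat) (R : realType) (g : R -> nat -> R) (al be : R) :
  kolmogorov a D g -> kolmogorov a D (fun u k => al + be * g u k).
Proof.
move=> gK u k u0; have dg := gK u k u0.
have h : is_derive u 1 (cst al + be *: (g ^~ k)) (0 + be *: ((a * k)%:R * (g u k.-1 - g u k) +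
    (a * k + D)%:R * (g u k.+1 - g u k))) by exact: is_deriveD.
apply: (is_derive_eq h); rewrite add0r /GRing.scale/=.
by rewrite mulrDr; congr (_ + _); rewrite opprD addrACA subrr add0r -mulrBr mulrCA.
Qed.

Section process_pgf.
Variables (a D k0 : nat) (keep : seq ('I_2 * nat) -> 'I_2 -> nat -> nat -> bitseq).
Hypotheses (a_gt0 : (0 < a)%N) (D_gt0 : (0 < D)%N) (keepP : removal_rule keep).
Context d (T : measurableType d) (R : realType) (P : probability T R).
Variable clock : nat * 'I_2 * nat -> {RV P >-> R}.
Hypothesis clock_indep : mutually_independent clock.
Hypothesis clock_exp : forall i V, measurable V ->
  distribution P (clock i) V = exponential_prob 1 V.
Local Open Scope ereal_scope.
Local Notation urn_at := (urn_at a D k0 keep clock).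

(** The inequality E X <= g(t, k0) applied to phi = c z^k and to
    phi = 1 - c z^k, for which X is replaced by 1 - X; the two bounds add up to
    1, as do the two means. *)
Lemma expectation_pgf (t sg c : R) (X : T -> R) :
  (0 <= t)%R -> (0 <= sg <= 1)%R -> (0 <= c <= 1)%R ->
  measurable_fun setT X -> (forall w, 0 <= X w <= 1)%R ->
  {ae P, forall w, forall n, (epoch (urn_at w n) <= t < epoch (urn_at w n.+1))%R ->
    X w = (c * (1 - sg) ^+ pairs a (urn_at w n))%R} ->
  \int[P]_w (X w)%:E = (c * pgf a D sg t k0)%:E.
Proof.
move=> t0 /andP[sg0 sg1] /andP[c0 c1] mX X01 XE.
have z0 k : (0 <= (1 - sg) ^+ k)%R by rewrite exprn_ge0// subr_ge0.
have z1 k : ((1 - sg) ^+ k <= 1)%R by rewrite exprn_ile1 ?subr_ge0// gerBl.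
have g01 u k : (0 <= u)%R -> (0 <= pgf a D sg u k <= 1)%R by exact: pgf_bounds.
have mg al be k : measurable_fun setT ((fun u j => al + be * pgf a D sg u j)%R ^~ k).
  by apply: measurable_funD => //; apply: measurable_funM => //; exact: measurable_pgf.
have bE al be : (forall u k, 0 <= u -> 0 <= al + be * pgf a D sg u k)%R ->
    backward_equation a D (fun k => al + be * (1 - sg) ^+ k)%R
      (fun u k => al + be * pgf a D sg u k)%R.
  move=> g0; have gK := @kolmogorov_affine a D R _ al be (kolmogorov_pgf D a_gt0 sg0).
  by apply: (backward_of_kolmogorov gK _ (mg al be) g0) => k; rewrite pgf0.
have g0 u k : (0 <= u -> 0 <= 0 + c * pgf a D sg u k)%R.
  by move=> u0; rewrite add0r mulr_ge0//; case/andP: (g01 u k u0).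
have g1 u k : (0 <= u -> 0 <= 1 + - c * pgf a D sg u k)%R.
  by move=> u0; case/andP: (g01 u k u0) => *; rewrite mulNr subr_ge0 mulr_ile1.
have le1 : \int[P]_w (X w)%:E <= (c * pgf a D sg t k0)%:E.
  have phi0 k : (0 <= 0 + c * (1 - sg) ^+ k)%R by rewrite add0r mulr_ge0.
  have := expectation_le_backward a_gt0 D_gt0 keepP clock_indep clock_exp t0 phi0 (mg 0%R c) g0
    (bE _ _ g0) mX X01.
  move=> /(_ k0); rewrite add0r; apply.
  by apply: filterS XE => w XE n /XE ->; rewrite add0r.
have le2 : \int[P]_w (1 - X w)%:E <= (1 - c * pgf a D sg t k0)%:E.
  have phi1 k : (0 <= 1 + - c * (1 - sg) ^+ k)%R by rewrite mulNr subr_ge0 mulr_ile1.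
  have mX1 : measurable_fun setT (fun w => 1 - X w)%R by exact: measurable_funB.
  have X101 w : (0 <= 1 - X w <= 1)%R.
    by have /andP[? ?] := X01 w; rewrite subr_ge0 gerBl; apply/andP.
  have := expectation_le_backward a_gt0 D_gt0 keepP clock_indep clock_exp t0 phi1
    (mg 1%R (- c)%R) g1
    (bE _ _ g1) mX1 X101.
  move=> /(_ k0); rewrite mulNr; apply.
  by apply: filterS XE => w XE n /XE ->; rewrite mulNr.
have sum1 : \int[P]_w (X w)%:E + \int[P]_w (1 - X w)%:E = 1.
  rewrite -ge0_integralD//.
  - transitivity (\int[P]_w (1 : \bar R)); last exact: integral_probability_cst.
    by apply: eq_integral => w _; rewrite -EFinD addrCA subrr addr0.
  - by move=> w _; have /andP[] := X01 w.
  - exact/measurable_EFinP.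
  - by move=> w _; have /andP[] := X01 w; rewrite lee_fin subr_ge0.
  - by apply/measurable_EFinP; exact: measurable_funB.
have I0 : 0 <= \int[P]_w (X w)%:E.
  by apply: integral_ge0 => w _; have /andP[] := X01 w.
have J0 : 0 <= \int[P]_w (1 - X w)%:E.
  by apply: integral_ge0 => w _; have /andP[] := X01 w; rewrite lee_fin subr_ge0.
move: (\int[P]_w (X w)%:E) (\int[P]_w (1 - X w)%:E) le1 le2 sum1 I0 J0.
move=> [x| |] [y| |]//; rewrite -EFinD !lee_fin => h1 h2 /eqP.
rewrite eqe => /eqP h3 _ _.
by congr EFin; apply/eqP; rewrite eq_le h1/=; lra.
Qed.

End process_pgf.

(** * Thresholds made of exponentials *)

Section threshold.
Variable R : realType.
Implicit Types (w y v th eta : R) (N : nat).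

Lemma bernoulli_lower w N : 0 <= w <= 1 -> 1 - N%:R * w <= (1 - w) ^+ N.
Proof.
move=> /andP[w0 w1]; elim: N => [|N IHN]; first by rewrite mul0r subr0 expr0.
rewrite exprS; apply: (@le_trans _ _ ((1 - w) * (1 - N%:R * w))).
  rewrite -natr1 [leRHS](_ : _ = 1 - (N%:R + 1) * w + N%:R * w ^+ 2); last by ring.
  by rewrite lerDl mulr_ge0// exprn_ge0.
by rewrite ler_wpM2l// subr_ge0.
Qed.

Lemma bernoulli_upper w N : 0 <= w <= 1 -> (1 - w) ^+ N * (1 + N%:R * w) <= 1.
Proof.
move=> /andP[w0 w1]; elim: N => [|N IHN]; first by rewrite mul0r addr0 expr0 mulr1.
apply: le_trans IHN; rewrite exprSr -mulrA ler_wpM2l ?exprn_ge0 ?subr_ge0//.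
rewrite -natr1 [leLHS](_ : _ = 1 + N%:R * w - (N%:R + 1) * w ^+ 2); last by ring.
by rewrite gerBl mulr_ge0// ?exprn_ge0// addr_ge0.
Qed.

(** The least integer above exp (theta y): for an exponential variable of rate
    theta, (1 - exp (- theta v))^N is the distribution function of the maximum
    of N copies, which concentrates at v = y. *)
Definition threshold_exponent th y : nat := (Num.trunc (expR (th * y))).+1.

Definition threshold th y v : R := (1 - expR (- (th * v))) ^+ threshold_exponent th y.

Lemma threshold_bounds th y v : 0 <= th -> 0 <= v -> 0 <= threshold th y v <= 1.
Proof.
move=> th0 v0; have w1 : expR (- (th * v)) <= 1 by rewrite -expR0 ler_expR oppr_le0 mulr_ge0.
by rewrite exprn_ge0 ?exprn_ile1 ?subr_ge0 ?gerBl ?expR_ge0.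
Qed.

Lemma threshold_below th y eta v : 0 <= th -> 0 <= v -> v <= y - eta ->
  threshold th y v <= expR (- (th * eta)).
Proof.
move=> th0 v0 vy; set w := expR (- (th * v)).
have w01 : 0 <= w <= 1 by rewrite expR_ge0 -expR0 ler_expR oppr_le0 mulr_ge0.
have := bernoulli_upper (threshold_exponent th y) w01; rewrite -/(threshold th y v).
have h0 : 0 <= threshold th y v by case/andP: (threshold_bounds y th0 v0).
have Nw : expR (th * eta) <= 1 + (threshold_exponent th y)%:R * w.
  apply: (@le_trans _ _ (expR (th * y) * w)).
    by rewrite -expRD ler_expR -mulrBr ler_wpM2l//; lra.
  apply: (@le_trans _ _ ((threshold_exponent th y)%:R * w)); last by rewrite lerDr.
  by rewrite ler_wpM2r ?expR_ge0// ltW// truncnS_gt.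
move=> H; rewrite expRN -[leRHS]mul1r ler_pdivlMr ?expR_gt0//.
by apply: le_trans H; rewrite ler_wpM2l.
Qed.

Lemma threshold_above th y eta v : 0 <= th -> 0 <= y -> 0 <= v -> y + eta <= v ->
  1 - 2 * expR (- (th * eta)) <= threshold th y v.
Proof.
move=> th0 y0 v0 vy; set w := expR (- (th * v)).
have w01 : 0 <= w <= 1 by rewrite expR_ge0 -expR0 ler_expR oppr_le0 mulr_ge0.
apply: le_trans (bernoulli_lower (threshold_exponent th y) w01); rewrite lerD2l lerN2.
apply: (@le_trans _ _ (2 * expR (th * y) * w)).
  rewrite ler_wpM2r ?expR_ge0// /threshold_exponent -natr1.
  have e1 : 1 <= expR (th * y) by rewrite -expR0 ler_expR mulr_ge0.
  by rewrite mulr_natl mulr2n lerD// truncn_le expR_ge0.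
rewrite -mulrA ler_wpM2l// -expRD ler_expR -mulrBr -mulrN ler_wpM2l//; lra.
Qed.

End threshold.

Section sandwich.
Context d (T : measurableType d) (R : realType) (P : probability T R) (Z : T -> R).
Hypotheses (mZ : measurable_fun setT Z) (Z0 : forall w, 0 <= Z w).

Lemma bounded_integrable (f : T -> R) (c : R) : measurable_fun setT f ->
  (forall w, `|f w| <= c) -> P.-integrable setT (EFin \o f).
Proof.
move=> mf fc; apply: measurable_bounded_integrable => //.
  by rewrite [ltLHS]probability_setT ltry.
exists c; split; first by rewrite num_real.
by move=> M cM w _; exact: le_trans (fc w) (ltW cM).
Qed.

Lemma integrableBR (f g : T -> R) : P.-integrable setT (EFin \o f) ->
  P.-integrable setT (EFin \o g) -> P.-integrable setT (EFin \o (fun w => f w - g w)).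
Proof. by move=> fi gi; exact: (integrableB measurableT fi gi). Qed.

Lemma integrableDR (f g : T -> R) : P.-integrable setT (EFin \o f) ->
  P.-integrable setT (EFin \o g) -> P.-integrable setT (EFin \o (fun w => f w + g w)).
Proof. by move=> fi gi; exact: (integrableD measurableT fi gi). Qed.

Lemma measurable_threshold (th y : R) : measurable_fun setT (fun w => threshold th y (Z w)).
Proof.
apply: measurable_funX; apply: measurable_funB => //.
apply: measurableT_comp => //; apply: measurableT_comp => //.
exact: measurable_funM.
Qed.

Lemma measurable_Zle c : measurable [set w | Z w <= c].
Proof.
rewrite -[X in measurable X]setTI; have := measurable_fun_ler mZ (measurable_cst c).
by move=> /(_ measurableT [set true]); apply.
Qed.

Lemma Rintegral_indic_le c : \int[P]_w (\1_[set w | Z w <= c] w) = fine (P [set w | Z w <= c]).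
Proof. by rewrite /Rintegral integral_indic// ?setIT//; exact: measurable_Zle. Qed.

Lemma integrable_indic c : P.-integrable setT (EFin \o \1_[set w | Z w <= c]).
Proof.
apply: (@bounded_integrable _ 1); first by apply: measurable_indic; exact: measurable_Zle.
by move=> w; rewrite indicE; case: (_ \in _); rewrite ?normr0 ?normr1.
Qed.

(** The mean of 1 - [threshold] lies between the distribution functions at y - eta
    and y + eta, up to an error that vanishes as theta grows. *)
Lemma sandwich th y eta : 0 <= th -> 0 <= y ->
  fine (P [set w | Z w <= y - eta]) - 2 * expR (- (th * eta)) <=
  1 - \int[P]_w threshold th y (Z w) <=
  fine (P [set w | Z w <= y + eta]) + 2 * expR (- (th * eta)).
Proof.
move=> th0 y0.
have ih : P.-integrable setT (EFin \o (fun w => threshold th y (Z w))).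
  apply: (@bounded_integrable _ 1); first exact: measurable_threshold.
  by move=> w; have /andP[? ?] := threshold_bounds y th0 (Z0 w); rewrite ger0_norm.
have icst c : P.-integrable setT (EFin \o cst c).
  exact: (@bounded_integrable _ `|c|).
have e0 : 0 <= expR (- (th * eta)) by exact: expR_ge0.
set dl := 2 * expR _; have dl0 : 0 <= dl by rewrite mulr_ge0.
have cstE c : \int[P]_w c = c.
  by rewrite Rintegral_cst// [X in fine X]probability_setT mulr1.
have hE : \int[P]_w (1 - threshold th y (Z w)) = 1 - \int[P]_w threshold th y (Z w).
  by rewrite RintegralB ?cstE//; exact: icst.
have ih1 : P.-integrable setT (EFin \o (fun w => 1 - threshold th y (Z w))).
  by apply: integrableBR => //; exact: icst.
have indic01 c w : \1_[set w | Z w <= c] w = (Z w <= c)%R%:R :> R.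
  by rewrite indicE; congr (nat_of_bool _)%:R; apply/idP/idP => [/set_mem|/mem_set].
rewrite -hE; apply/andP; split.
  rewrite -Rintegral_indic_le -[X in _ - X <= _]cstE -RintegralB//; last 2 first.
  - exact: integrable_indic.
  - exact: icst.
  apply: le_Rintegral => //.
    by apply: integrableBR; [exact: integrable_indic|exact: icst].
  move=> w _; rewrite indic01; have /andP[h0 h1] := threshold_bounds y th0 (Z0 w).
  case: (leP (Z w) (y - eta)) => Zy /=.
    by rewrite lerD2l lerN2 (le_trans (threshold_below th0 (Z0 w) Zy))// /dl ler_peMl// ler1n.
  by rewrite sub0r (@le_trans _ _ 0) ?oppr_le0// subr_ge0.
rewrite -Rintegral_indic_le -[X in _ <= _ + X]cstE -RintegralD//; last 2 first.
- exact: integrable_indic.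
- exact: icst.
apply: le_Rintegral => //.
  by apply: integrableDR; [exact: integrable_indic|exact: icst].
move=> w _; rewrite indic01; have /andP[h0 h1] := threshold_bounds y th0 (Z0 w).
case: (leP (Z w) (y + eta)) => Zy /=.
  by rewrite lerD// (@le_trans _ _ 0) ?oppr_le0.
by have := threshold_above th0 y0 (Z0 w) (ltW Zy); rewrite add0r -/dl lerBlDl lerBlDr.
Qed.

End sandwich.

(** * Convergence of Laplace transforms implies convergence in distribution *)

(** F, Fu and Fl stand for the limiting distribution function at a point, to its
    right and to its left, and p for the prelimiting one at that point.  I and J
    are the means of the thresholds under the limit and before it, and dl is the
    error in [sandwich]. *)
Lemma cdf_comparison (R : realType) (e p F Fu Fl Iu Ju Il Jl dl : R) :
  `|F - Fu| <= e / 4 -> `|F - Fl| <= e / 4 -> `|Iu - Ju| <= e / 4 -> `|Il - Jl| <= e / 4 ->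
  dl <= e / 4 -> p - dl <= 1 - Ju -> 1 - Jl <= p + dl -> 1 - Iu <= Fu + dl -> Fl - dl <= 1 - Il ->
  `|F - p| <= e.
Proof.
rewrite !ler_norml => /andP[? ?] /andP[? ?] /andP[? ?] /andP[? ?] *.
by apply/andP; split; lra.
Qed.

Section laplace_continuity.
Context d (T : measurableType d) (R : realType) (P : probability T R) (X : R -> T -> R).
Context d' (T' : measurableType d') (M : probability T' R) (Y : T' -> R).
Hypotheses (mX : forall t, measurable_fun setT (X t)) (X0 : forall t w, 0 < t -> 0 <= X t w).
Hypotheses (mY : measurable_fun setT Y) (Y0 : forall w, 0 <= Y w).
Hypothesis laplace : forall th, 0 <= th ->
  \int[P]_w expR (- (th * X t w)) @[t --> +oo] --> \int[M]_w expR (- (th * Y w)).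

(* The extra factor exp (- kappa v) makes the induction on N go through: one
   factor 1 - exp (- theta v) turns h into a difference of two functions h. *)
Let h N (th ka v : R) := (1 - expR (- (th * v))) ^+ N * expR (- (ka * v)).

Lemma integrable_laplace d0 (T0 : measurableType d0) (P0 : probability T0 R) (Z : T0 -> R) N th ka :
  0 <= th -> 0 <= ka -> measurable_fun setT Z -> (forall w, 0 <= Z w) ->
  P0.-integrable setT (EFin \o (fun w => h N th ka (Z w))).
Proof.
move=> th0 ka0 mZ Z0; have mE c : measurable_fun setT (fun w => expR (- (c * Z w))).
  by apply: measurableT_comp => //; apply: measurableT_comp => //; exact: measurable_funM.
apply: (@bounded_integrable _ _ _ _ _ 1).
  by apply: measurable_funM => //; apply: measurable_funX; exact: measurable_funB.
have e1 c w : 0 <= c -> expR (- (c * Z w)) <= 1.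
  by move=> c0; rewrite -expR0 ler_expR oppr_le0 mulr_ge0.
move=> w; have t1 : 0 <= 1 - expR (- (th * Z w)) by rewrite subr_ge0 e1.
rewrite ger0_norm ?mulr_ge0 ?exprn_ge0 ?expR_ge0// mulr_ile1 ?exprn_ge0 ?expR_ge0 ?e1//.
by rewrite exprn_ile1// gerBl expR_ge0.
Qed.

Lemma cvg_laplace_poly N th ka : 0 <= th -> 0 <= ka ->
  \int[P]_w h N th ka (X t w) @[t --> +oo] --> \int[M]_w h N th ka (Y w).
Proof.
move=> th0; elim: N ka => [|N IHN] ka ka0.
  rewrite /h; under eq_fun do under eq_Rintegral do rewrite expr0 mul1r.
  by under eq_Rintegral do rewrite expr0 mul1r; exact: laplace.
have hE v : h N.+1 th ka v = h N th ka v - h N th (th + ka) v.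
  by rewrite /h exprS [(th + ka) * v]mulrDl opprD expRD; ring.
have kt : 0 <= th + ka by rewrite addr_ge0.
have -> : \int[M]_w h N.+1 th ka (Y w) =
    \int[M]_w (h N th ka (Y w) - h N th (th + ka) (Y w)).
  by apply: eq_Rintegral => w _; exact: hE.
rewrite RintegralB//; [|exact: integrable_laplace..].
apply: (cvg_trans _ (cvgB (IHN ka ka0) (IHN _ kt))).
apply: near_eq_cvg; near=> t => /=.
have Xt w : 0 <= X t w by apply: X0; near: t; exact: nbhs_pinfty_gt.
apply: (etrans (esym (RintegralB measurableT (integrable_laplace P N th0 ka0 (mX t) Xt)
  (integrable_laplace P N th0 kt (mX t) Xt)))).
by apply: eq_Rintegral => w _; rewrite -hE.
Unshelve. all: by end_near. Qed.

Lemma cvg_threshold th y : 0 <= th ->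
  \int[P]_w threshold th y (X t w) @[t --> +oo] --> \int[M]_w threshold th y (Y w).
Proof.
move=> th0; have := @cvg_laplace_poly (threshold_exponent th y) th 0 th0 (lexx 0).
have hE v : h (threshold_exponent th y) th 0 v = threshold th y v.
  by rewrite /h mul0r oppr0 expR0 mulr1.
by under eq_fun do under eq_Rintegral do rewrite hE; under eq_Rintegral do rewrite hE.
Qed.

(** The thresholds at x + eta and x - eta have converging means.  By [sandwich] for
    the prelimit, they enclose its distribution function at x; by [sandwich] for
    the limit, they lie between its distribution functions at x - 2 eta and
    x + 2 eta, which are close by continuity at x. *)
Lemma laplace_cvg_cdf x : 0 < x ->
  {for x, continuous (fun y : R => M [set w | Y w <= y])} ->
  P [set w | X t w <= x] @[t --> +oo] --> M [set w | Y w <= x].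
Proof.
move=> x0 cF; pose F y := fine (M [set w | Y w <= y]).
have finM y : M [set w | Y w <= y] \is a fin_num by exact/fin_num_measure/measurable_Zle.
have cFr : F y @[y --> x] --> F x.
  by move: cF; rewrite /continuous_at /prop_for /= -(fineK (finM x)) => /fine_cvgP[_].
rewrite -(fineK (finM x)); apply/fine_cvgP; split.
  by near=> t; apply/fin_num_measure/measurable_Zle.
apply/cvgrPdist_le => e e0; rewrite -/(F x).
have e4 : 0 < e / 4 by rewrite divr_gt0.
move/cvgrPdist_lt : cFr => /(_ _ e4) [dl /= dl0 Fdl].
pose eta := Num.min dl x / 3.
have m0 : 0 < Num.min dl x by rewrite lt_min dl0 x0.
have eta0 : 0 < eta by rewrite divr_gt0.
have eta_dl : 2 * eta < dl.
  have : Num.min dl x <= dl by rewrite ge_min lexx.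
  by rewrite /eta; move: (Num.min dl x) m0 => m *; lra.
have eta_x : eta < x.
  have : Num.min dl x <= x by rewrite ge_min lexx orbT.
  by rewrite /eta; move: (Num.min dl x) m0 => m *; lra.
(* This choice makes 2 exp (- theta eta) at most e / 4, since
   exp (8 / e) >= 8 / e. *)
pose th := 8 / (e * eta).
have th0 : 0 <= th by rewrite divr_ge0// mulr_ge0// ltW.
have err : 2 * expR (- (th * eta)) <= e / 4.
  have -> : th * eta = 8 / e by rewrite /th; field; rewrite !gt_eqF.
  rewrite expRN -ler_pdivlMl// [leRHS](_ : _ = (8 / e)^-1); last by field; rewrite gt_eqF.
  rewrite lef_pV2 ?posrE ?expR_gt0 ?divr_gt0//.
  by apply: le_trans (expR_ge1Dx _); rewrite lerDr.
have close y : `|x - y| <= 2 * eta -> `|F x - F y| <= e / 4.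
  by move=> xy; apply/ltW/Fdl; exact: le_lt_trans eta_dl.
have /cvgrPdist_le/(_ _ e4) up := @cvg_threshold th (x + eta) th0.
have /cvgrPdist_le/(_ _ e4) lo := @cvg_threshold th (x - eta) th0.
have closeu : `|F x - F (x + eta + eta)| <= e / 4.
  apply: close; rewrite (_ : x - _ = - (2 * eta)); last by ring.
  by rewrite normrN ger0_norm// mulr_ge0// ltW.
have closel : `|F x - F (x - eta - eta)| <= e / 4.
  apply: close; rewrite (_ : x - _ = 2 * eta); last by ring.
  by rewrite ger0_norm// mulr_ge0// ltW.
have yu : 0 <= x + eta by rewrite addr_ge0 ?ltW.
have yl : 0 <= x - eta by rewrite subr_ge0 ltW.
have /andP[_ Mu] := sandwich M mY Y0 eta th0 yu.
have /andP[Ml _] := sandwich M mY Y0 eta th0 yl.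
have pos : \forall t \near +oo, 0 < (t : R) by exact: nbhs_pinfty_gt.
apply: filterS3 up lo pos => t upt lot t0.
have X0t w : 0 <= X t w by exact: X0.
have /andP[Pu _] := sandwich P (mX t) X0t eta th0 yu.
have /andP[_ Pl] := sandwich P (mX t) X0t eta th0 yl.
rewrite addrK in Pu; rewrite subrK in Pl.
exact: (cdf_comparison closeu closel upt lot err Pu Pl Mu Ml).
Unshelve. all: by end_near. Qed.

End laplace_continuity.

(** * The gamma function *)

Section gamma_function.
Variables (R : realType) (alpha : R).
Hypothesis alpha_gt0 : 0 < alpha.
Local Notation mu := (@lebesgue_measure R).

Lemma continuous_powR_gt0 (r x : R) : 0 < x -> {for x, continuous (fun y : R => y `^ r)}.
Proof.
move=> x0; apply/differentiable_continuous/derivable1_diffP.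
by apply: derivable_powR; rewrite in_itv/= x0.
Qed.

Lemma integral_powR_itv (b : R) : 0 < b -> b < 1 ->
  (\int[mu]_(x in `[b, 1%R]) (x `^ (alpha - 1))%:E <= (alpha^-1)%:E)%E.
Proof.
move=> b0 b1.
rewrite (@continuous_FTC2 R _ (fun x : R => alpha^-1 * x `^ alpha))//.
- rewrite -EFinB lee_fin powR1 mulr1 gerBl mulr_ge0 ?powR_ge0// invr_ge0 ltW//.
- apply: continuous_in_subspaceT => s; rewrite inE/= in_itv/= => /andP[bs _].
  by apply: continuous_powR_gt0; exact: lt_le_trans bs.
- have dF s : 0 < s -> derivable (fun x : R => alpha^-1 * x `^ alpha) s 1.
    by move=> s0; apply: derivableM => //; apply: derivable_powR; rewrite in_itv/= s0.
  have cF s : 0 < s -> {for s, continuous (fun x : R => alpha^-1 * x `^ alpha)}.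
    by move=> s0; apply/differentiable_continuous/derivable1_diffP/dF.
  split.
  + by move=> s; rewrite in_itv/= => /andP[bs _]; apply: dF; exact: lt_trans bs.
  + by apply: cvg_at_right_filter; exact: cF.
  + by apply: cvg_at_left_filter; exact: cF.
- move=> s; rewrite in_itv/= => /andP[bs _]; have s0 := lt_trans b0 bs.
  rewrite derive1Ml; last by apply: derivable_powR; rewrite in_itv/= s0.
  by rewrite powR_derive1 ?in_itv/= ?s0// mulrA mulVf ?mul1r// gt_eqF.
Qed.

(** The integrand is unbounded at 0 if alpha < 1, hence the exhaustion by the
    intervals [1 / (n + 2), 1]. *)
Lemma integral_powR_01 :
  (\int[mu]_(x in `]0%R, 1%R]) (x `^ (alpha - 1))%:E <= (alpha^-1)%:E)%E.
Proof.
pose b (n : nat) : R := n.+2%:R^-1.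
have b0 n : 0 < b n by rewrite invr_gt0.
have b1 n : b n < 1 by rewrite invf_lt1// ltr1n.
have -> : `]0%R, 1%R]%classic = \bigcup_n `[b n, 1%R]%classic :> set R.
  apply/seteqP; split => x /=.
    rewrite in_itv/= => /andP[x0 x1].
    exists (Num.trunc x^-1) => //=; rewrite in_itv/= x1 andbT.
    rewrite /b -[leRHS]invrK lef_pV2 ?posrE ?invr_gt0// ltW//.
    by rewrite (lt_trans (truncnS_gt _))// ltr_nat.
  by move=> [n _] /=; rewrite !in_itv/= => /andP[bx ->]; rewrite (lt_le_trans (b0 n) bx).
have mf : measurable_fun [set: R] (fun x : R => (x `^ (alpha - 1))%:E).
  by apply/measurable_EFinP; exact: measurable_powR.
have H : (\int[mu]_(x in `[b n, 1%R]) (x `^ (alpha - 1))%:E @[n --> \oo] -->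
   \int[mu]_(x in \bigcup_n `[b n, 1%R]%classic) (x `^ (alpha - 1))%:E)%E.
  apply: ge0_nondecreasing_set_cvg_integral.
  - move=> m n mn; apply/subsetPset => x /=; rewrite !in_itv/= => /andP[bx ->]; rewrite andbT.
    by apply: le_trans bx; rewrite lef_pV2 ?posrE// ler_nat !ltnS.
  - by [].
  - by move=> n; exact: measurable_funTS.
  - by move=> n x _; rewrite lee_fin powR_ge0.
rewrite -(cvg_lim _ H)//; apply: lime_le; first by apply/cvg_ex; eexists; exact: H.
by near=> n; exact: integral_powR_itv.
Unshelve. all: by end_near. Qed.

(** From ln v <= v - 1 at v = x / (2 alpha); this choice leaves half of the
    exponential decay. *)
Lemma powR_le_expR (x : R) : 1 <= x ->
  x `^ (alpha - 1) <= expR (alpha * ln (2 * alpha) - alpha) * expR (x / 2).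
Proof.
move=> x1; have x0 : 0 < x by exact: lt_le_trans x1.
have a2 : 0 < 2 * alpha by rewrite mulr_gt0.
rewrite (le_trans (ler_powR x1 (_ : alpha - 1 <= alpha)))//; first by rewrite gerBl.
rewrite /powR gt_eqF// -expRD ler_expR.
have : ln (x / (2 * alpha)) <= x / (2 * alpha) - 1.
  by have := @le_ln1Dx R (x / (2 * alpha) - 1); rewrite addrCA subrr addr0; apply;
     rewrite ltrBrDr addNr divr_gt0.
rewrite ln_div ?posrE// => /(ler_wpM2l (ltW alpha_gt0)).
rewrite !mulrBr mulr1.
rewrite (_ : alpha * (x / (2 * alpha)) = x / 2); last by field; rewrite gt_eqF.
lra.
Qed.

Local Notation integrand x := (x `^ (alpha - 1) * expR (- x))%R.

Lemma measurable_gamma_integrand (B : set R) :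
  measurable_fun B (fun x : R => (integrand x)%:E).
Proof.
apply: measurable_funTS; apply/measurable_EFinP; apply: measurable_funM.
  exact: measurable_powR.
exact: measurableT_comp.
Qed.

Lemma gamma_integral_lty : (\int[mu]_(x in `]0%R, +oo[) (integrand x)%:E < +oo)%E.
Proof.
have g0 (x : R) : (0 <= (integrand x)%:E)%E by rewrite lee_fin mulr_ge0 ?powR_ge0 ?expR_ge0.
rewrite (@itv_bndbnd_setU _ _ (BRight 0) (BRight 1) +oo%O)//; last by rewrite bnd_simp.
rewrite ge0_integral_setU//=; last 2 first.
- exact: measurable_gamma_integrand.
- apply/disj_set2P; rewrite -subset0 => x /=.
  rewrite !in_itv/= andbT => -[/andP[_ x1] /lt_le_trans].
  by move=> /(_ _ x1); rewrite ltxx.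
rewrite lte_add_pinfty//.
  apply: (@le_lt_trans _ _ (\int[mu]_(x in `]0%R, 1%R]) (x `^ (alpha - 1))%:E)%E).
    apply: ge0_le_integral => //.
    - exact: measurable_gamma_integrand.
    - by apply: measurable_funTS; apply/measurable_EFinP; exact: measurable_powR.
    - move=> x /=; rewrite in_itv/= => /andP[x0 _].
      by rewrite lee_fin ler_piMr ?powR_ge0// -expR0 ler_expR oppr_le0 ltW.
  by apply: (le_lt_trans integral_powR_01); rewrite ltry.
pose K := expR (alpha * ln (2 * alpha) - alpha).
apply: (@le_lt_trans _ _ (\int[mu]_(x in `]0%R, +oo[) (K%:E * (expR (- (2^-1 * x)))%:E))%E).
  apply: (@le_trans _ _ (\int[mu]_(x in `]1%R, +oo[) (K%:E * (expR (- (2^-1 * x)))%:E))%E).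
    apply: ge0_le_integral => //.
    - exact: measurable_gamma_integrand.
    - apply: emeasurable_funM => //; apply: measurable_funTS.
      apply/measurable_EFinP; apply: measurableT_comp => //.
      by apply: measurableT_comp => //; exact: measurable_funM.
    - move=> x /=; rewrite in_itv/= andbT => x1; rewrite -EFinM lee_fin.
      apply: le_trans (ler_wpM2r (expR_ge0 _) (powR_le_expR (ltW x1))) _.
      rewrite -mulrA -expRD ler_wpM2l ?expR_ge0// ler_expR; lra.
  apply: ge0_subset_integral => //.
  - apply: emeasurable_funM => //; apply: measurable_funTS.
    apply/measurable_EFinP; apply: measurableT_comp => //.
    by apply: measurableT_comp => //; exact: measurable_funM.
  - by move=> x _; rewrite -EFinM lee_fin mulr_ge0 ?expR_ge0.
  - by apply: subset_itvr; rewrite bnd_simp.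
rewrite ge0_integralZl ?lee_fin ?expR_ge0//.
  by rewrite integral_expR_scale// -EFinM ltry.
apply: measurable_funTS; apply/measurable_EFinP; apply: measurableT_comp => //.
by apply: measurableT_comp => //; exact: measurable_funM.
Qed.

Lemma gamma_funE :
  (\int[mu]_(x in `]0%R, +oo[) (integrand x)%:E = (gamma_fun alpha)%:E)%E.
Proof.
rewrite /gamma_fun /Rintegral fineK// ge0_fin_numE ?gamma_integral_lty//.
by apply: integral_ge0 => x _; rewrite lee_fin mulr_ge0 ?powR_ge0 ?expR_ge0.
Qed.

(** On [1, 2] the integrand is at least exp (- 2) / 2, as x^(alpha - 1) is at
    least 1 / x. *)
Lemma gamma_fun_gt0 : 0 < gamma_fun alpha.
Proof.
rewrite -lte_fin -gamma_funE.
have c0 : 0 < 2^-1 * expR (- 2) :> R by rewrite mulr_gt0 ?invr_gt0 ?expR_gt0.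
apply: (@lt_le_trans _ _ (\int[mu]_(x in `[1%R, 2%R]) (2^-1 * expR (- 2) : R)%:E)%E).
  rewrite integral_cst//= lebesgue_measure_itv/= lte_fin ltr1n -EFinB.
  by rewrite -EFinM lte_fin mulr_gt0// subr_gt0 ltr1n.
apply: (@le_trans _ _ (\int[mu]_(x in `[1%R, 2%R]) (integrand x)%:E)%E).
  apply: ge0_le_integral => //.
  - exact: measurable_gamma_integrand.
  - move=> x /=; rewrite in_itv/= => /andP[x1 x2]; have x0 : 0 < x by exact: lt_le_trans x1.
    rewrite lee_fin ler_pM ?invr_ge0 ?expR_ge0// ?ler_expR ?lerN2//.
    apply: le_trans (ler_powR x1 (_ : -1 <= alpha - 1)); last by rewrite lerBrDr addNr ltW.
    by rewrite (powR_inv1 (ltW x0)) lef_pV2 ?posrE.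
apply: ge0_subset_integral => //.
- exact: measurable_gamma_integrand.
- by move=> x _; rewrite lee_fin mulr_ge0 ?powR_ge0 ?expR_ge0.
- by move=> x /=; rewrite !in_itv/= andbT => /andP[/(lt_le_trans ltr01)].
Qed.

End gamma_function.

(** * The gamma law and its Laplace transform *)

Section gamma_law.
Variables (R : realType) (alpha beta : R).
Hypotheses (alpha_gt0 : 0 < alpha) (beta_gt0 : 0 < beta).
Local Notation mu := (@lebesgue_measure R).
Local Notation pdf := (gamma_pdf alpha beta).

Lemma gamma_pdf_ge0 x : 0 <= pdf x.
Proof.
rewrite /gamma_pdf; case: ifP => // _.
by rewrite divr_ge0 ?mulr_ge0 ?powR_ge0 ?expR_ge0 ?ltW ?gamma_fun_gt0.
Qed.

Lemma measurable_gamma_pdf : measurable_fun [set: R] pdf.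
Proof.
apply: measurable_fun_ifT => //; first exact: measurable_fun_ltr.
apply: measurable_funM => //; apply: measurable_funM; first exact: measurable_powR.
apply: measurableT_comp => //; apply: measurableT_comp => //.
exact: measurable_funM.
Qed.

(** The substitution x = beta y / (1 + beta theta) turns the integrand into a
    multiple of that of the gamma function.  The case theta = 0 shows that the
    density has total mass 1. *)
Lemma gamma_laplace (th : R) : 0 <= th ->
  (\int[mu]_x ((expR (- (th * x)))%:E * (pdf x)%:E) =
  (expR (- alpha * ln (1 + beta * th)))%:E)%E.
Proof.
move=> th0; set q := 1 + beta * th.
have q0 : 0 < q by rewrite ltr_pwDl// mulr_ge0// ltW.
have k0 : 0 < beta / q by rewrite divr_gt0.
have G0 := gamma_fun_gt0 alpha_gt0.
rewrite (@ge0_integral_affine _ (beta / q) 0)//; last 2 first.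
- apply: emeasurable_funM; first exact: measurable_expR_scale.
  by apply/measurable_EFinP; exact: measurable_gamma_pdf.
- by move=> x; rewrite -EFinM lee_fin mulr_ge0 ?expR_ge0 ?gamma_pdf_ge0.
pose c := (beta / q) `^ (alpha - 1) / (gamma_fun alpha * beta `^ alpha).
have c0 : 0 <= c by rewrite divr_ge0 ?powR_ge0// mulr_ge0 ?powR_ge0 ?ltW.
have -> : (\int[mu]_x ((expR (- (th * (beta / q * x + 0))))%:E * (pdf (beta / q * x + 0))%:E) =
    \int[mu]_(x in `]0%R, +oo[) (c%:E * (x `^ (alpha - 1) * expR (- x))%:E))%E.
  rewrite [RHS]integral_mkcond; apply: eq_integral => x _.
  rewrite patchE mem_setE in_itv/= andbT addr0 /gamma_pdf pmulr_rgt0//.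
  case: ifPn => x0; last by rewrite mule0.
  rewrite -!EFinM; congr EFin; rewrite powRM ?(ltW k0) ?(ltW x0)//.
  have -> : expR (- x) = expR (- (th * (beta / q * x))) * expR (- (beta / q * x / beta)).
    by rewrite -expRD; congr expR; rewrite /q; field; rewrite -/q !gt_eqF.
  by rewrite /c; ring.
rewrite ge0_integralZl ?lee_fin//; last 2 first.
- exact: measurable_gamma_integrand.
- by move=> x _; rewrite lee_fin mulr_ge0 ?powR_ge0 ?expR_ge0.
rewrite gamma_funE// -!EFinM; congr EFin.
have bq : beta / q * (beta / q) `^ (alpha - 1) = (beta / q) `^ alpha.
  by rewrite mulr_powRB1// ltW.
rewrite /c !mulrA bq powRM ?invr_ge0 ?ltW//.
have -> : expR (- alpha * ln q) = q^-1 `^ alpha.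
  by rewrite /powR gt_eqF ?invr_gt0// lnV ?posrE// mulNr mulrN.
have b0 := powR_gt0 alpha beta_gt0.
by field; rewrite !gt_eqF.
Qed.

Lemma integral_gamma_pdf : (\int[mu]_x (pdf x)%:E = 1)%E.
Proof.
have := gamma_laplace (lexx 0); rewrite mulr0 addr0 ln1 mulr0 expR0 => <-.
by apply: eq_integral => x _; rewrite mul0r oppr0 expR0 mul1e.
Qed.

Local Notation gamma := (gamma_prob alpha beta).

Let gamma0 : gamma set0 = 0%E.
Proof. by rewrite /gamma_prob integral_set0. Qed.

Let gamma_ge0 A : (0 <= gamma A)%E.
Proof. by apply: integral_ge0 => x _; rewrite lee_fin gamma_pdf_ge0. Qed.

Let gamma_sigma_additive : semi_sigma_additive (gamma : set (measurableTypeR R) -> \bar R).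
Proof.
move=> /= F mF tF mUF; rewrite /gamma_prob; apply: cvg_toP.
  apply: ereal_nondecreasing_is_cvgn => m n mn.
  by apply: lee_sum_nneg_natr => // k _ _; exact: gamma_ge0.
rewrite ge0_integral_bigcup//=.
- by apply: measurable_funTS; apply/measurable_EFinP; exact: measurable_gamma_pdf.
- by move=> x _; rewrite lee_fin gamma_pdf_ge0.
Qed.

HB.instance Definition _ := isMeasure.Build _ _ _
  (gamma : set (measurableTypeR R) -> \bar R) gamma0 gamma_ge0 gamma_sigma_additive.

Let gamma_setT : gamma [set: R] = 1%E.
Proof. by rewrite /gamma_prob integral_gamma_pdf. Qed.

HB.instance Definition _ :=
  @Measure_isProbability.Build _ _ R (gamma : set (measurableTypeR R) -> \bar R) gamma_setT.

End gamma_law.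

Definition gamma_law (R : realType) (alpha beta : R) (alpha_gt0 : 0 < alpha) (beta_gt0 : 0 < beta) :
  probability (measurableTypeR R) R.
Proof.
refine (gamma_prob alpha beta : probability (measurableTypeR R) R).
exact: alpha_gt0. exact: beta_gt0.
Defined.

(** The negative half-line is a null set, so the variable may be replaced by its
    positive part; the latter is nonnegative everywhere, as [laplace_cvg_cdf]
    requires of the limit. *)
Lemma gamma_law_laplace (R : realType) (alpha beta th : R)
    (alpha_gt0 : 0 < alpha) (beta_gt0 : 0 < beta) :
  0 <= th ->
  \int[gamma_law alpha_gt0 beta_gt0]_v expR (- (th * Num.max v 0)) =
  expR (- alpha * ln (1 + beta * th)).
Proof.
move=> th0; have mm : measurable_fun [set: R] (fun v : R => (expR (- (th * Num.max v 0)))%:E).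
  apply/measurable_EFinP; apply: measurableT_comp => //; apply: measurableT_comp => //.
  by apply: measurable_funM => //; exact: measurable_maxr.
rewrite /Rintegral (@ge0_integral_density _ _ _ (@lebesgue_measure R) _ (gamma_pdf alpha beta))//.
- transitivity (fine (expR (- alpha * ln (1 + beta * th)))%:E); last by [].
  rewrite -(gamma_laplace alpha_gt0 beta_gt0 th0).
  congr fine; apply: eq_integral => x _; rewrite /gamma_pdf.
  case: ifPn => x0; last by rewrite !mule0.
  by rewrite max_l// ltW.
- exact: measurable_gamma_pdf.
- exact: gamma_pdf_ge0.
Qed.

(** * The scaling limit *)

Section scaling_limit.
Variables (R : realType) (a D k0 : nat) (c : R).
Hypotheses (c_ge0 : 0 <= c).

Lemma cvg_invr_pinfty : (t^-1 @[t --> +oo] --> (0 : R)).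
Proof.
apply/(gtr0_cvgV0 (f := id)); last exact: cvg_id.
exact: nbhs_pinfty_gt.
Qed.

Lemma cvg_div_pinfty (r : R) : r / t @[t --> +oo] --> (0 : R).
Proof. by rewrite -(mulr0 r); apply: cvgM; [exact: cvg_cst|exact: cvg_invr_pinfty]. Qed.

(** From 1 + v <= exp v at v = - c / t and at v = c / t. *)
Lemma cvg_scaled_loss : t * (1 - expR (- (c / t))) @[t --> +oo] --> c.
Proof.
apply: (@squeeze_cvgr _ _ _ _ (fun t => c / (1 + c / t)) (fun=> c)).
- near=> t; have t0 : 0 < t by near: t; exact: nbhs_pinfty_gt.
  have ct0 : 0 <= c / t by rewrite divr_ge0// ltW.
  apply/andP; split; last first.
    rewrite -ler_pdivlMl// mulrC lerBlDr -lerBlDl.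
    exact: expR_ge1Dx.
  rewrite -ler_pdivrMl// [leLHS](_ : _ = 1 - (1 + c / t)^-1); last first.
    by field; rewrite !gt_eqF// ltr_pwDl.
  rewrite lerD2l lerN2 expRN lef_pV2 ?posrE ?expR_gt0 ?ltr_pwDl//.
  exact: expR_ge1Dx.
- rewrite -[X in _ --> X]divr1; apply: cvgM; first exact: cvg_cst.
  apply: cvgV; first exact: oner_neq0.
  rewrite -[X in _ --> X]addr0; apply: cvgD; [exact: cvg_cst|exact: cvg_div_pinfty].
- exact: cvg_cst.
Unshelve. all: by end_near. Qed.

Lemma cvg_expR_div (r : R) : expR (- (r / t)) @[t --> +oo] --> (1 : R).
Proof.
rewrite -expR0; apply: continuous_cvg; first exact: continuous_expR.
by rewrite -oppr0; apply: cvgN; exact: cvg_div_pinfty.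
Qed.

Lemma cvg_pgf :
  pgf a D (1 - expR (- (c / t))) t k0 @[t --> +oo] -->
  expR (- (D%:R / a%:R) * ln (1 + a%:R * c)).
Proof.
have cs : 1 + a%:R * (1 - expR (- (c / t))) * t @[t --> +oo] --> 1 + a%:R * c.
  apply: cvgD; first exact: cvg_cst.
  rewrite (_ : (fun t => _) = (fun t => a%:R * (t * (1 - expR (- (c / t)))))).
    by apply: cvgM; [exact: cvg_cst|exact: cvg_scaled_loss].
  by apply/funext => t; rewrite -mulrA; congr (_ * _); rewrite mulrC.
have cl : log_scale a (1 - expR (- (c / t))) t @[t --> +oo] --> ln (1 + a%:R * c).
  by apply: continuous_cvg cs; apply: continuous_ln; rewrite ltr_pwDl// mulr_ge0.
pose f t := 1 - (1 - expR (- (c / t))) * inv_scale a (1 - expR (- (c / t))) t.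
have cf : f t @[t --> +oo] --> (1 : R).
  rewrite -[X in _ --> X]subr0; apply: cvgB; first exact: cvg_cst.
  rewrite -(mul0r (expR (- ln (1 + a%:R * c)))); apply: cvgM.
    by rewrite -(subrr 1); apply: cvgB; [exact: cvg_cst|exact: cvg_expR_div].
  by apply: continuous_cvg; [exact: continuous_expR|exact: cvgN].
have cfk k : f t ^+ k @[t --> +oo] --> (1 : R).
  elim: k => [|k IHk]; first by under eq_fun do rewrite expr0; exact: cvg_cst.
  have -> : (fun t => f t ^+ k.+1) = f * (fun t => f t ^+ k).
    by apply/funext => t; rewrite exprS.
  have h := cvgM cf IHk; rewrite mulr1 in h. exact: h.
rewrite -[X in _ --> X]mulr1; apply: cvgM; last exact: cfk.
apply: continuous_cvg; first exact: continuous_expR.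
by apply: cvgM cl; exact: cvg_cst.
Qed.

End scaling_limit.

(** Both B(t) / t and (W(t) + B(t)) / (2 t) have the form (a k + delta) / t, with
    delta = D and delta = D / 2 respectively; the constant disappears in the
    limit. *)
Section limit_law.
Variables (a D k0 : nat) (keep : seq ('I_2 * nat) -> 'I_2 -> nat -> nat -> bitseq).
Hypotheses (a_gt0 : (0 < a)%N) (D_gt0 : (0 < D)%N) (keepP : removal_rule keep).
Context d (T : measurableType d) (R : realType) (P : probability T R).
Variable clock : nat * 'I_2 * nat -> {RV P >-> R}.
Hypothesis clock_indep : mutually_independent clock.
Hypothesis clock_exp : forall i V, measurable V ->
  distribution P (clock i) V = exponential_prob 1 V.
Local Notation urn_at := (urn_at a D k0 keep clock).
Variables (delta : R) (Z : R -> T -> R).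
Hypothesis delta_gt0 : 0 < delta.
Hypothesis mZ : forall t, measurable_fun setT (Z t).
Hypothesis Z_ge0 : forall t w, 0 < t -> 0 <= Z t w.
Hypothesis ZE : {ae P, forall w, forall n t,
  epoch (urn_at w n) <= t < epoch (urn_at w n.+1) ->
  Z t w = ((a * pairs a (urn_at w n))%:R + delta) / t}.

(** The generating function at z = exp (- theta a / t). *)
Lemma laplace_count (t th : R) : 0 < t -> 0 <= th ->
  \int[P]_w expR (- (th * Z t w)) =
  expR (- (th * delta / t)) * pgf a D (1 - expR (- (th * a%:R / t))) t k0.
Proof.
move=> t0 th0.
have sg01 : 0 <= 1 - expR (- (th * a%:R / t)) <= 1.
  by rewrite subr_ge0 gerBl expR_ge0 andbT -expR0 ler_expR oppr_le0 divr_ge0 ?mulr_ge0// ltW.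
have c01 : 0 <= expR (- (th * delta / t)) <= 1.
  by rewrite expR_ge0 -expR0 ler_expR oppr_le0 divr_ge0 ?mulr_ge0// ltW.
have mX : measurable_fun setT (fun w => expR (- (th * Z t w))).
  apply: measurableT_comp => //; apply: measurableT_comp => //.
  exact: measurable_funM.
have X01 w : 0 <= expR (- (th * Z t w)) <= 1.
  by rewrite expR_ge0 -expR0 ler_expR oppr_le0 mulr_ge0// Z_ge0.
have XE : {ae P, forall w, forall n, epoch (urn_at w n) <= t < epoch (urn_at w n.+1) ->
    expR (- (th * Z t w)) = expR (- (th * delta / t)) *
      (1 - (1 - expR (- (th * a%:R / t)))) ^+ pairs a (urn_at w n)}.
  apply: filterS ZE => w ZEw n /ZEw ->.
  rewrite subKr -expRM_natl -expRD natrM; congr expR.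
  by field; rewrite gt_eqF.
by rewrite /Rintegral (expectation_pgf a_gt0 D_gt0 keepP clock_indep clock_exp
  (ltW t0) sg01 c01 mX X01 XE).
Qed.

(** Z t is positive wherever it is prescribed, that is where t lies before the
    limit of the epochs.  That this is almost sure follows from
    [expectation_pgf] with c = 0. *)
Lemma null_nonpositive (t x : R) : 0 < t -> x <= 0 -> P [set w | Z t w <= x] = 0%E.
Proof.
move=> t0 x0.
have mA : measurable [set w | Z t w <= x] by exact: measurable_Zle.
have s01 : (0 <= (0 : R) <= 1) by rewrite lexx ler01.
have mX : measurable_fun setT (\1_[set w | Z t w <= x] : T -> R) by exact: measurable_indic.
have X01 w : 0 <= (\1_[set w | Z t w <= x] w : R) <= 1.
  by rewrite indicE; case: (_ \in _); rewrite ?lexx ?ler01.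
have XE : {ae P, forall w, forall n, epoch (urn_at w n) <= t < epoch (urn_at w n.+1) ->
    \1_[set w | Z t w <= x] w = 0 * (1 - 0) ^+ pairs a (urn_at w n) :> R}.
  apply: filterS ZE => w ZEw n /ZEw Zw; rewrite mul0r indicE memNset//= Zw.
  by apply/negP; rewrite -ltNge (le_lt_trans x0)// divr_gt0// ltr_wpDl.
have := expectation_pgf a_gt0 D_gt0 keepP clock_indep clock_exp (ltW t0) s01 s01 mX X01 XE.
by rewrite integral_indic// setIT mul0r.
Qed.

(** For x > 0 the Laplace transforms decide; for x <= 0 both sides vanish. *)
Lemma gamma_limit (x : R) :
  let gamma := gamma_prob (D%:R / a%:R) (a%:R ^+ 2) in
  {for x, continuous (fun y : R => gamma `]-oo, y]%classic)} ->
  P [set w | Z t w <= x] @[t --> +oo] --> gamma `]-oo, x]%classic.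
Proof.
move=> gamma cgamma.
have aR0 : 0 < a%:R :> R by rewrite ltr0n.
have alpha0 : 0 < D%:R / a%:R :> R by rewrite divr_gt0// ltr0n.
have beta0 : 0 < a%:R ^+ 2 :> R by rewrite exprn_gt0.
pose M := gamma_law alpha0 beta0.
have [x0|x0] := leP x 0.
  rewrite (_ : gamma _ = 0%E).
    apply: cvg_near_cst; near=> t; apply: null_nonpositive => //.
  rewrite /gamma /gamma_prob integral0_eq// => v; rewrite /= in_itv/= => vx.
  by rewrite /gamma_pdf ltNge (le_trans vx x0).
have ME y : 0 <= y -> M [set v | Num.max v 0 <= y] = gamma `]-oo, y]%classic.
  move=> y0; congr (gamma _); apply/seteqP; split => v /=; rewrite in_itv/= ge_max y0 andbT//.
rewrite -ME ?ltW//.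
apply: laplace_cvg_cdf => //.
- exact: measurable_maxr.
- by move=> v; rewrite le_max lexx orbT.
- move=> th th0; rewrite gamma_law_laplace//.
  have tha : 0 <= th * a%:R by rewrite mulr_ge0.
  have h := cvgM (cvg_expR_div (th * delta)) (@cvg_pgf R a D k0 _ tha).
  rewrite mul1r (_ : a%:R * (th * a%:R) = a%:R ^+ 2 * th) in h; last by ring.
  apply: (cvg_trans _ (h _)); apply: near_eq_cvg; near=> t => /=.
  by rewrite laplace_count.
- have cM : {near x, (fun y => gamma `]-oo, y]%classic) =1 (fun y => M [set v | Num.max v 0 <= y])}.
    near=> y; rewrite ME//; apply/ltW; near: y; exact: lt_nbhsr.
  rewrite /continuous_at /prop_for /= ME ?ltW//.
  by apply: cvg_trans cgamma; apply: near_eq_cvg.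
Unshelve. all: by end_near. Qed.

End limit_law.

(** * The constant-differentials urn *)

(** Otherwise w0 %/ a successive draws of white balls would leave w0 %% a of them,
    fewer than the a to be removed at the next such draw. *)
Lemma tenable_dvd (a w0 b0 : nat) : (0 < a)%N -> (w0 <= b0)%N ->
  tenable (constant_differentials a) (by_colour w0 b0) -> (a %| w0)%N.
Proof.
move=> a_gt0 wb ten.
have down j : (a * j <= w0)%N ->
    reachable (constant_differentials a) (by_colour w0 b0)
      (by_colour (w0 - a * j)%N (b0 - a * j)%N).
  elim: j => [|j IHj] ajw; first by rewrite muln0 !subn0; exact: reachable_init.
  have ajw' : (a * j + a <= w0)%N by rewrite addnC -mulnS.
  have ajw1 : (a * j <= w0)%N by rewrite (leq_trans _ ajw')// leq_addr.
  apply: (reachable_draw (c := white) (IHj ajw1)).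
    by rewrite /by_colour/= subn_gt0 (leq_trans _ ajw')// -addn1 leq_add2l.
  move=> e; rewrite !mxE /by_colour/= mulnS addnC !subnDA.
  by case: (e == white); rewrite subzn// leq_subRL// (leq_trans _ wb)//.
have := ten _ (down (w0 %/ a)%N _); rewrite mulnC leq_trunc_div => /(_ isT) [_ /(_ white)].
rewrite /by_colour/= => H; rewrite /dvdn -leqn0 leqNgt; apply/negP => r0.
have rE : (w0 - w0 %/ a * a = w0 %% a)%N by rewrite {1}(divn_eq w0 a) addKn.
have := H _ white; rewrite rE mxE /by_colour/= => /(_ r0).
by rewrite subr_ge0 lez_nat leqNgt ltn_mod a_gt0.
Qed.

Theorem corollary2 (R : realType) (d : measure_display) (T : measurableType d)
    (P : probability T R) (a w0 b0 : nat) (Delta : int)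
    (W B : R -> {RV P >-> nat}) :
  (1 <= a)%N ->
  Delta = b0%:Z - w0%:Z ->
  1 <= Delta ->
  tenable (constant_differentials a) (by_colour w0 b0) ->
  polya_process (constant_differentials a) (by_colour w0 b0) (by_colour W B) ->
  let tau t w := (W t w + B t w)%N in
  let Gamma := gamma_prob (Delta%:~R / a%:R) (a%:R ^+ 2) in
  cvg_in_distribution P (fun t w => (B t w)%:R / t) Gamma /\
  cvg_in_distribution P (fun t w => (tau t w)%:R / t)
    (pushforward Gamma (fun x : R => 2 * x)).
Proof.
move=> a_gt0 DE D1 ten [keep [clock [keepP indep expo ae]]] tau.
pose D := (b0 - w0)%N.
have wb : (w0 < b0)%N by rewrite -ltz_nat -subr_gt0 -DE (lt_le_trans _ D1).
have D_gt0 : (0 < D)%N by rewrite subn_gt0.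
have {DE D1} -> : Delta = D%:Z by rewrite DE subzn// ltnW.
have /dvdnP[k0 w0E] := tenable_dvd a_gt0 (ltnW wb) ten.
have {w0E} w0E : w0 = (a * k0)%N by rewrite w0E mulnC.
have b0E : b0 = (a * k0 + D)%N by rewrite -w0E subnKC// ltnW.
clearbody D; subst w0 b0.
rewrite -pmulrn => Gamma.
have cnt : {ae P, forall w, forall n t,
    epoch (urn_at a D k0 keep clock w n) <= t < epoch (urn_at a D k0 keep clock w n.+1) ->
    W t w = (a * pairs a (urn_at a D k0 keep clock w n))%N /\
    B t w = (a * pairs a (urn_at a D k0 keep clock w n) + D)%N}.
  apply: filterS ae => w /= ae n t h.
  have [k [sw sb]] : exists k, has_shape a D (rings (urn_at a D k0 keep clock w n)) k.
    apply: (@shape_iter_draw a D keep a_gt0 D_gt0 keepP R _ _ k0).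
    by split; rewrite /= size_mkseq.
  have := ae n t h white; have := ae n t h blue; rewrite /by_colour/= => -> ->.
  by rewrite /pairs sw sb mulKn.
have mnat (f : T -> nat) : measurable_fun setT f -> measurable_fun setT (fun w => (f w)%:R : R).
  by move=> mf; apply: (@measurableT_comp _ _ _ _ _ _ (fun n : nat => n%:R : R)).
have mB t : measurable_fun setT (fun w => (B t w)%:R : R) by exact: mnat.
have mW t : measurable_fun setT (fun w => (W t w)%:R : R) by exact: mnat.
have DR : 0 < D%:R :> R by rewrite ltr0n.
split => x cx.
  apply: (gamma_limit a_gt0 D_gt0 keepP indep expo DR) => //.
  - by move=> t; apply: measurable_funM.
  - by move=> t w t0; rewrite divr_ge0// ltW.
  - by apply: filterS cnt => w cnt n t /cnt[_ ->]; rewrite natrD.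
pose Z t w : R := (tau t w)%:R / (2 * t).
have D2 : 0 < D%:R / 2 :> R by rewrite divr_gt0.
have mZ t : measurable_fun setT (Z t).
  apply: measurable_funM => //; rewrite /tau; under eq_fun do rewrite natrD.
  exact: measurable_funD.
have pre (y : R) : pushforward Gamma (fun x : R => 2 * x) `]-oo, y]%classic =
    Gamma `]-oo, y / 2]%classic.
  congr (Gamma _); apply/seteqP; split => v; rewrite /= !in_itv/= ler_pdivlMr// mulrC//.
have H : P [set w | Z t w <= x / 2] @[t --> +oo] --> Gamma `]-oo, x / 2]%classic.
  apply: (gamma_limit a_gt0 D_gt0 keepP indep expo D2) => //.
  - by move=> t w t0; rewrite divr_ge0// mulr_ge0// ltW.
  - apply: filterS cnt => w cnt n t h; have [Ww Bw] := cnt n t h.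
    rewrite /Z /tau Ww Bw !natrD invfM mulrA; congr (_ / _).
    by field.
  have -> : (fun y => Gamma `]-oo, y]%classic) =
      (fun y => pushforward Gamma (fun v : R => 2 * v) `]-oo, y]%classic) \o ( *%R 2).
    by apply/funext => y; rewrite /= pre mulrAC divff// mul1r.
  apply: continuous_comp; first exact: mulrl_continuous.
  by rewrite mulrCA divff// mulr1.
rewrite pre; apply: cvg_trans H; apply: near_eq_cvg; near=> t.
have t0 : 0 < t by near: t; exact: nbhs_pinfty_gt.
by congr (P _); apply/seteqP; split => w /=;
  rewrite /Z invfM [2^-1 * _]mulrC mulrA ler_pM2r ?invr_gt0.
Unshelve. all: by end_near. Qed.
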